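(* Let $\theta_3\in(\pi_{3,2})^{-1}(\mathrm{Orb}_2^0)$, $\theta_2=\pi_{3,2}(\theta_3)$, $p=\pi_3(\theta_3)$. For a horizontal subspace $H\subset\mathcal A_{\theta_3}$ satisfying $$\rho_{3,1}\bigl([\,j_p^4X,\,j_p^4Y\,]\bigr)=0\qquad\forall\,j_p^4X,j_p^4Y\in H,\qquad( * )$$ the tensor $\omega^3_H=\beta_{\theta_2}\lrcorner\,\tilde\mu(t_H)\in g^2\otimes(T_p^*\wedge T_p^* )^3$ is independent of the choice of the horizontal subspace $H\subset\mathcal A_{\theta_3}$ satisfying $( * )$.
   Context: All manifolds and maps are smooth; repeated indices are summed. Let $\pi:\mathbb R^2\times\mathbb R^4\to\mathbb R^2$ be the product bundle with base coordinates $(x^1,x^2)=(x,y)$ and fibre coordinates $u^1,\dots,u^4$; its sections $p\mapsto(p,a^0(p),a^1(p),a^2(p),a^3(p))$ are identified with equations $y''=a^3y'^3+a^2y'^2+a^1y'+a^0$. A point transformation is a diffeomorphism $f$ of an open subset of $\mathbb R^2$ onto an open subset of $\mathbb R^2$. Its lift $f^{(0)}$ sends $(p,u)$ to $(f(p),\tilde u)$, where, with $g=(g^1,g^2)=f^{-1}$, subscripts denoting partial derivatives at $f(p)$, $A=g^1_1+g^1_2t$, $B=g^2_1+g^2_2t$, $Q^i=g^i_{11}+2g^i_{12}t+g^i_{22}t^2$, $J=g^1_1g^2_2-g^1_2g^2_1$, the $\tilde u^i$ are determined by the identity in $t$: $\sum_{i=0}^3\tilde u^{i+1}t^i=J^{-1}\bigl(\sum_{i=0}^3u^{i+1}B^iA^{3-i}-AQ^2+BQ^1\bigr)$.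 $J^k\pi$ is the bundle of $k$-jets of sections of $\pi$, with projections $\pi_k:J^k\pi\to\mathbb R^2$, $\pi_{k,r}:J^k\pi\to J^r\pi$ and coordinates $u^i_\sigma$; $j_kS:p\mapsto j^k_pS$; $f^{(k)}(j^k_pS)=j^k_{f(p)}(f^{(0)}\circ S\circ f^{-1})$. A vector field $X$ on the base with flow $f_t$ lifts to the vector field $X^{(k)}$ on $J^k\pi$ with flow $f_t^{(k)}$. Put $F^1=3u^1_{22}-2u^2_{12}+u^3_{11}+3u^4u^1_1-3u^3u^1_2+2u^2u^2_2-u^2u^3_1-3u^1u^3_2+6u^1u^4_1$, $F^2=u^2_{22}-2u^3_{12}+3u^4_{11}-3u^1u^4_2+3u^2u^4_1-2u^3u^3_1+u^3u^2_2+3u^4u^2_1-6u^4u^1_2$; $\mathrm{Orb}_2^0=\{(F^1,F^2)\neq0\}\subset J^2\pi$, and $\beta_{\theta_2}=(F^2(\theta_2)\partial_{x^1}-F^1(\theta_2)\partial_{x^2})\otimes(dx^1\wedge dx^2)^2\in T_p\otimes(T_p^*\wedge T_p^* )^2$. $W_p$ is the Lie algebra of $\infty$-jets at $p$ of vector fields on $\mathbb R^2$, $L^k_p\subset W_p$ the jets with zero $k$-jet; $W_p/L^k_p$ is the space of $k$-jets, $T_p=W_p/L^0_p$ is the tangent space, $\rho_{i,j}:W_p/L_p^i\to W_p/L_p^j$ the projection; the Lie bracket ($[X,Y]^i=X^jY^i_j-Y^jX^i_j$) induces $[\cdot,\cdot]:W_p/L^k_p\times W_p/L^k_p\to W_p/L^{k-1}_p$.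 One identifies $L_p^0/L_p^1\cong T_p\otimes T_p^*$ and $L^1_p/L^2_p\cong T_p\otimes S^2T_p^*$ via components $X^i_j$, $X^i_{jk}$. For $\theta_3=j^3_pS$, $\theta_2=j^2_pS$, let $\mathcal K_{\theta_3}$ be the tangent space at $\theta_2$ to the image of $j_2S$, and $\mathcal A_{\theta_3}=\{j^4_pX\in W_p/L_p^4: X^{(2)}_{\theta_2}\in\mathcal K_{\theta_3}\}$. A 2-dimensional subspace $H\subset\mathcal A_{\theta_3}$ is horizontal if $\rho_{4,0}|_H:H\to T_p$ is an isomorphism. $g^2\subset L_p^1/L_p^2$ is given by $X^2_{11}=0$, $X^1_{11}=2X^2_{12}$, $2X^1_{12}=X^2_{22}$, $X^1_{22}=0$. Definition of $t_H$ for horizontal $H\subset\mathcal A_{\theta_3}$ satisfying $( * )$: for $X_p,Y_p,Z_p,U_p\in T_p$ let $j_p^4X,j_p^4Y,j_p^4Z,j_p^4U\in H$ be the elements over them, $w=[j_p^3Z,[j_p^4X,j_p^4Y]]\in W_p/L^2_p$ (it lies in $L_p^0/L_p^2$), and let $j_p^4\tilde Z\in H$ be the unique element with $\tilde Z_p=\rho_{1,0}([j_p^2U,w])$. Then $t_H(X_p,Y_p,Z_p,U_p)=[j_p^2U,w]-j_p^1\tilde Z\in L_p^0/L_p^1\cong T_p\otimes T_p^*$. This defines a tensor $t_H$, which lies in $T_p\otimes(T_p^*\odot T_p^*\odot T_p^* )\otimes(T_p^*\wedge T_p^* )\subset T_p\otimes(T_p^*\odot T_p^* )\otimes T_p^*\otimes(T_p^*\wedge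 T_p^* )$, the last factor being the one for $X_p,Y_p$. $\mu:T_p\otimes(T_p^*\odot T_p^* )\to g^2$ is the projection $(X^i_{jk})\mapsto\bigl(\tfrac13(\delta^i_jX^r_{kr}+\delta^i_kX^r_{jr})\bigr)$, and $\tilde\mu=\mu\otimes\mathrm{id}:T_p\otimes(T_p^*\odot T_p^* )\otimes T_p^*\otimes(T_p^*\wedge T_p^* )\to g^2\otimes T_p^*\otimes(T_p^*\wedge T_p^* )$. The contraction $\lrcorner$ of $T_p\otimes(T_p^*\wedge T_p^* )^2$ with $g^2\otimes T_p^*\otimes(T_p^*\wedge T_p^* )$ contracts the vector factor $T_p$ with the middle factor $T_p^*$, with result in $g^2\otimes(T_p^*\wedge T_p^* )^3$. *)

(* Defs.v *)
From HB Require Import structures.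
From mathcomp Require Import all_boot all_order all_algebra.
From mathcomp Require Import all_classical all_reals all_analysis.
Import Order.TTheory GRing.Theory Num.Theory.
Import numFieldNormedType.Exports.

Set Implicit Arguments.
Unset Strict Implicit.
Unset Printing Implicit Defensive.

Local Open Scope classical_set_scope.
Local Open Scope ring_scope.

(* Index conventions: the base coordinate x^j is coordinate number j-1 of
   'rV[R]_2 and the fibre coordinate u^i is coordinate number i-1 of 'rV[R]_4. *)
Notation plane R := 'rV[R]_2.
Notation fibre R := 'rV[R]_4.
Notation i1 := (@Ordinal 2 0 isT).
Notation i2 := (@Ordinal 2 1 isT).

(* C^oo on an open set U of a finite-dimensional space: all iterated directional
   derivatives exist as differentiable (hence continuous) functions on U. *)
Definition smooth_on {R : realType} {V W : normedModType R} (U : set V)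
    (f : V -> W) : Prop :=
  forall (s : seq V) (x : V), U x ->
    differentiable (foldr (fun v g => 'D_v g) f s) x.

Definition partial {R : realType} (j : 'I_2) (f : plane R -> R) : plane R -> R :=
  'D_(delta_mx 0 j) f.

(* d^(a+b) f / dx^a dy^b *)
Definition pderiv {R : realType} (a b : nat) (f : plane R -> R) : plane R -> R :=
  iter a (partial i1) (iter b (partial i2) f).

(* multi-indices sigma = (a, b), i.e. a times x^1 and b times x^2, of order <= k *)
Definition midx (k : nat) : finType :=
  {m : 'I_k.+1 * 'I_k.+1 | (m.1 + m.2 <= k)%N}.

(* k-jets at a point of maps from the plane to R^n, given by the values of all
   the partial derivatives of order <= k of the n components.  In particular
   jet R 2 k is W_p / L^k_p and jet R 2 0 is T_p. *)
Notation jet R n k := {ffun 'I_n * midx k -> R^o}.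

(* Points of J^k pi: base point and coordinates u^i_sigma, |sigma| <= k; tangent
   vectors of J^k pi, written in these coordinates, have the same type. *)
Notation Jpi R k := (plane R * jet R 4 k)%type.

(* The coordinate of index (i, (a, b)): the sum has exactly one term if
   a + b <= k and is empty otherwise. *)
Definition jcoef {R : realType} {n k : nat} (xi : jet R n k)
    (i : 'I_n) (a b : nat) : R :=
  \sum_(m : midx k | ((val m).1 == a :> nat) && ((val m).2 == b :> nat)) xi (i, m).

Definition mkjet {R : realType} (n k : nat) (F : 'I_n -> nat -> nat -> R) :
    jet R n k :=
  [ffun c : 'I_n * midx k => (F c.1 (val c.2).1 (val c.2).2 : R^o)].

Definition jet_of {R : realType} {n : nat} (k : nat) (F : plane R -> 'rV[R]_n)
    (p : plane R) : jet R n k :=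
  mkjet k (fun i a b => pderiv a b (fun q => F q 0 i) p).

(* rho_{k,l} (and, fibrewise, pi_{k,l}), for l <= k *)
Definition rho {R : realType} {n k : nat} (l : nat) (xi : jet R n k) : jet R n l :=
  mkjet l (jcoef xi).

Definition pi_ {R : realType} {k : nat} (l : nat) (theta : Jpi R k) : Jpi R l :=
  (theta.1, rho l theta.2).

(* The coefficients of order (a, b) of [X,Y]^i = X^j Y^i_j - Y^j X^i_j, expanded
   by the Leibniz rule.  Those with a + b <= k only involve the coefficients of
   order <= k + 1 of X and Y. *)
Definition lie_coef {R : realType} (X Y : 'I_2 -> nat -> nat -> R)
    (i : 'I_2) (a b : nat) : R :=
  \sum_(j < 2) \sum_(c < a.+1) \sum_(d < b.+1) ('C(a, c) * 'C(b, d))%N%:R *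
    (X j c d * Y i (a - c + (j == i1))%N (b - d + (j == i2))%N
     - Y j c d * X i (a - c + (j == i1))%N (b - d + (j == i2))%N).

Definition bracket {R : realType} {k : nat} (xi eta : jet R 2 k.+1) : jet R 2 k :=
  mkjet k (lie_coef (jcoef xi) (jcoef eta)).

(* f^(0), for a point transformation f with inverse g *)
Definition point_lift {R : realType} (f g : plane R -> plane R)
    (z : plane R * fibre R) : plane R * fibre R :=
  let q := f z.1 in
  let dg i a b := pderiv a b (fun y => g y 0 i) q in
  let A := (dg i1 1%N 0%N)%:P + dg i1 0%N 1%N *: 'X in
  let B := (dg i2 1%N 0%N)%:P + dg i2 0%N 1%N *: 'X in
  let Q i := (dg i 2%N 0%N)%:P + (2 * dg i 1%N 1%N) *: 'X
             + dg i 0%N 2%N *: 'X^2 in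
  let J := dg i1 1%N 0%N * dg i2 0%N 1%N - dg i1 0%N 1%N * dg i2 1%N 0%N in
  let cubic := J^-1 *: (\sum_(i < 4) z.2 0 i *: (B ^+ i * A ^+ (3 - i))
                        - A * Q i2 + B * Q i1) in
  (q, \row_(i < 4) cubic`_i).

(* The fibre component of the section f^(0) o S o f^-1, where g = f^-1 *)
Definition transform_section {R : realType} (f g : plane R -> plane R)
    (S : plane R -> fibre R) : plane R -> fibre R :=
  fun q => (point_lift f g (g q, S (g q))).2.

(* f^(k) (j^k_p S), where g = f^-1 *)
Definition lift_jet {R : realType} (k : nat) (f g : plane R -> plane R)
    (S : plane R -> fibre R) (p : plane R) : Jpi R k :=
  (f p, jet_of k (transform_section f g S) (f p)).

(* f is the flow of X near p.  In particular f (- t) is the inverse of f t near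
   f t p for small t. *)
Definition local_flow {R : realType} (X : plane R -> plane R) (p : plane R)
    (f : R -> plane R -> plane R) : Prop :=
  exists (U : set (plane R)) (e : R),
    [/\ [/\ open U, U p & 0 < e],
        smooth_on [set z : R^o * plane R | `|z.1| < e /\ U z.2]
          (fun z => f z.1 z.2),
        forall x, U x -> f 0 x = x,
        forall t x, `|t| < e -> U x ->
          is_derive (t : R^o) (1 : R^o) (fun s : R^o => f s x) (X (f t x)) &
        forall s t x, `|s| < e -> `|t| < e -> `|s + t| < e ->
          U x -> U (f t x) -> f s (f t x) = f (s + t) x].

(* V is the value X^(k)_theta at theta of the lift of X: the velocity at t = 0,
   in the coordinates of J^k pi, of f_t^(k)(theta), with theta = j^k_p S; it does not depend on the choice
   of S and of the local flow. *)
Definition lift_vector {R : realType} (k : nat) (X : plane R -> plane R)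
    (theta V : Jpi R k) : Prop :=
  exists (S : plane R -> fibre R) (f : R -> plane R -> plane R),
    [/\ smooth_on setT S, jet_of k S theta.1 = theta.2, local_flow X theta.1 f,
        is_derive (0 : R^o) (1 : R^o)
          (fun t : R^o => (lift_jet k (f t) (f (- t)) S theta.1).1) V.1 &
        forall c, is_derive (0 : R^o) (1 : R^o)
          (fun t : R^o => (lift_jet k (f t) (f (- t)) S theta.1).2 c) (V.2 c)].

(* K_{theta_3}: the image of the differential at p of j_2 S, j^3_p S = theta_3 *)
Definition Kspace {R : realType} (theta3 : Jpi R 3) (V : Jpi R 2) : Prop :=
  exists (S : plane R -> fibre R) (v : plane R),
    [/\ smooth_on setT S, jet_of 3 S theta3.1 = theta3.2 &
        V = (v, [ffun c => 'D_v (fun q => jet_of 2 S q c : R^o) theta3.1])].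

Definition Aspace {R : realType} (theta3 : Jpi R 3) (xi : jet R 2 4) : Prop :=
  exists (X : plane R -> plane R) (V : Jpi R 2),
    [/\ smooth_on setT X, jet_of 4 X theta3.1 = xi,
        lift_vector X (pi_ 2 theta3) V & Kspace theta3 V].

(* u^i_sigma, 1 <= i <= 4, sigma = (a, b) *)
Local Notation u_ th i a b := (jcoef th.2 (@Ordinal 4 i.-1 isT) a b).

Definition F1 {R : realType} (th : Jpi R 2) : R :=
  3 * u_ th 1 0 2 - 2 * u_ th 2 1 1 + u_ th 3 2 0
  + 3 * u_ th 4 0 0 * u_ th 1 1 0 - 3 * u_ th 3 0 0 * u_ th 1 0 1
  + 2 * u_ th 2 0 0 * u_ th 2 0 1 - u_ th 2 0 0 * u_ th 3 1 0
  - 3 * u_ th 1 0 0 * u_ th 3 0 1 + 6 * u_ th 1 0 0 * u_ th 4 1 0.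

Definition F2 {R : realType} (th : Jpi R 2) : R :=
  u_ th 2 0 2 - 2 * u_ th 3 1 1 + 3 * u_ th 4 2 0
  - 3 * u_ th 1 0 0 * u_ th 4 0 1 + 3 * u_ th 2 0 0 * u_ th 4 1 0
  - 2 * u_ th 3 0 0 * u_ th 3 1 0 + u_ th 3 0 0 * u_ th 2 0 1
  + 3 * u_ th 4 0 0 * u_ th 2 1 0 - 6 * u_ th 4 0 0 * u_ th 1 0 1.

Definition Orb20 {R : realType} (theta : Jpi R 2) : Prop :=
  (F1 theta, F2 theta) != (0, 0).

(* The components beta^l of beta = beta^l d_{x^l} (x) (dx^1 /\ dx^2)^2 *)
Definition beta {R : realType} (theta : Jpi R 2) (l : 'I_2) : R :=
  if l == i1 then F2 theta else - F1 theta.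

Definition horizontal {R : realType} (theta3 : Jpi R 3) (H : {vspace jet R 2 4}) :
    Prop :=
  [/\ \dim H = 2%N,
      forall xi, xi \in H -> Aspace theta3 xi,
      {in H &, injective (rho 0 : jet R 2 4 -> jet R 2 0)} &
      forall v : jet R 2 0, exists2 xi : jet R 2 4, xi \in H & rho 0 xi = v].

Definition star_condition {R : realType} (H : {vspace jet R 2 4}) : Prop :=
  forall xi eta, xi \in H -> eta \in H -> rho 1 (bracket xi eta) = 0.

(* the element of H over v, for H horizontal *)
Definition over {R : realType} (H : {vspace jet R 2 4}) (v : jet R 2 0) :
    jet R 2 4 :=
  xget 0 [set xi : jet R 2 4 | xi \in H /\ rho 0 xi = v].

Definition t_tensor {R : realType} (H : {vspace jet R 2 4}) (X Y Z U : jet R 2 0) :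
    jet R 2 1 :=
  let w : jet R 2 2 := bracket (rho 3 (over H Z)) (bracket (over H X) (over H Y)) in
  let Uw : jet R 2 1 := bracket (rho 2 (over H U)) w in
  Uw - rho 1 (over H (rho 0 Uw)).

(* the coordinate vector d_{x^j} in T_p *)
Definition dvec (R : realType) (j : 'I_2) : jet R 2 0 :=
  mkjet 0 (fun i _ _ => (i == j)%:R).

(* the component X^i_j of an element of L^0_p / L^1_p *)
Definition comp1 {R : realType} (xi : jet R 2 1) (i j : 'I_2) : R :=
  jcoef xi i (j == i1) (j == i2).

(* Component arrays (X^i_{jk}) of elements of T_p (x) T_p^* (x) T_p^*, indexed by
   (i, j, k) *)
Notation tensor12 R := {ffun 'I_2 * 'I_2 * 'I_2 -> R}.

Definition mu {R : realType} (X : tensor12 R) : tensor12 R :=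
  [ffun c => let: (i, j, k) := c in
     3^-1 * ((i == j)%:R * (\sum_(r < 2) X (r, k, r))
             + (i == k)%:R * (\sum_(r < 2) X (r, j, r)))].

Definition in_g2 {R : realType} (X : tensor12 R) : Prop :=
  [/\ (forall i, X (i, i1, i2) = X (i, i2, i1)),
      X (i2, i1, i1) = 0, X (i1, i1, i1) = 2 * X (i2, i1, i2),
      2 * X (i1, i1, i2) = X (i2, i2, i2) & X (i1, i2, i2) = 0].

(* t_H(X, Y, Z, -) as an element of T_p (x) (T_p^* (.) T_p^* ): the symmetric pair
   consists of the covariant index of the value of t_H and of the argument U. *)
Definition t_slice {R : realType} (H : {vspace jet R 2 4}) (X Y Z : jet R 2 0) :
    tensor12 R :=
  [ffun c => let: (i, j, k) := c in comp1 (t_tensor H X Y Z (dvec R k)) i j].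

Definition mu_tilde_t {R : realType} (H : {vspace jet R 2 4}) (X Y Z : jet R 2 0) :
    tensor12 R := mu (t_slice H X Y Z).

(* omega^3_H = omega (x) (dx^1 /\ dx^2)^3 with omega in g^2: the vector factor of
   beta is contracted with the Z slot, and a 2-form in X, Y is its value on
   (d_{x^1}, d_{x^2}) times dx^1 /\ dx^2. *)
Definition omega3 {R : realType} (theta2 : Jpi R 2) (H : {vspace jet R 2 4}) :
    tensor12 R :=
  [ffun c => \sum_(l < 2)
     beta theta2 l * mu_tilde_t H (dvec R i1) (dvec R i2) (dvec R l) c].

Lemma mu_in_g2 (R : realType) (X : tensor12 R) : in_g2 (mu X).
Proof.
split=> [i|||| ]; rewrite !ffunE /=.
- by congr (_ * _); exact: addrC.
- by rewrite !mul0r addr0 mulr0.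
- by rewrite !mul0r !mul1r add0r mulrCA; congr (_ * _); rewrite mulr_natl mulr2n.
- by rewrite !mul0r !mul1r addr0 mulrCA; congr (_ * _); rewrite mulr_natl mulr2n.
- by rewrite !mul0r addr0 mulr0.
Qed.

Lemma omega3_in_g2 (R : realType) (theta2 : Jpi R 2) (H : {vspace jet R 2 4}) :
  in_g2 (omega3 theta2 H).
Proof.
have m l := mu_in_g2 (t_slice H (dvec R i1) (dvec R i2) (dvec R l)).
split=> [i|||| ]; rewrite !ffunE ?mulr_sumr.
- by apply: eq_bigr => l _; rewrite /mu_tilde_t; case: (m l) => ->.
- by rewrite big1 // => l _; rewrite /mu_tilde_t; case: (m l) => _ -> *; rewrite mulr0.
- by apply: eq_bigr => l _; rewrite /mu_tilde_t; case: (m l) => _ _ -> *; rewrite mulrCA.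
- by apply: eq_bigr => l _; rewrite /mu_tilde_t; case: (m l) => _ _ _ <- *; rewrite mulrCA.
- by rewrite big1 // => l _; rewrite /mu_tilde_t; case: (m l) => _ _ _ _ ->; rewrite mulr0.
Qed.

(* Main.v *)
Require Import Defs.
From mathcomp Require Import all_boot all_order all_algebra.
From mathcomp Require Import all_classical all_reals all_analysis.
From mathcomp Require Import ring lra.
Import Order.TTheory GRing.Theory Num.Theory.
Import numFieldNormedType.Exports.

(* A 4-jet belongs to A_{theta_3} iff the 2-jet of the Lie derivative of a section
   with 3-jet theta_3 along it vanishes.  Let X, Y in H lie over d_1, d_2.  Their
   bracket C is again an infinitesimal symmetry, to order 1, and its 1-jet is zero,
   so C_2 = delta c + delta c is in g^2 and C_3 is determined by C_2 and the section;
   eliminating the derivatives of the section gives c_k = F^k / 3, whatever H is.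
   Writing G^m_lk for the 1-jets of H (symmetric, by (star)) and g_l = G^r_lr, the
   trace of t_H that survives in mu is
     C^r_lkr + 3 G^m_lk c_m - c_k g_l - c_l g_k.
   Contracting with beta kills c_l, since beta^l F^l = 0.  Invariance of F gives
   G^m_lk F^m + g_l F^k = - D_l F^k, whose antisymmetric part determines beta^l g_l;
   hence the contraction depends on theta_3 only. *)

Set Implicit Arguments.
Unset Strict Implicit.
Unset Printing Implicit Defensive.

Local Open Scope classical_set_scope.
Local Open Scope ring_scope.

(** [Aspace] is defined through flows and smooth sections, whereas t_H is algebra in Taylor
    coefficients. The analysis serves a single passage between the two: differentiating the lifted
    flow at time zero. Since [smooth_on] supplies only differentiability of iterated directional
    derivatives, closure rules, equality of mixed derivatives and the Leibniz rule are built from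
    it. Afterwards jets are untruncated arrays of coefficients, and the identities are polynomial.
    The 1-jets G of H enter the trace of t_H and have no expression in theta_3; only the
    combinations controlled by the invariance of F can be removed. Under beta^l, the term 3 G^m_lk
    c_m is G^m_lk F^m, which invariance turns into - D_l F^k - g_l F^k. Together with - c_k g_l = -
    F^k g_l / 3 this makes the factor - 4/3 of F^k beta^l g_l. The symmetry of G in l and k then
    gives beta^l g_l = D_2 F^1 - D_1 F^2. *)

Lemma sum2E (V : nmodType) (F : 'I_2 -> V) : \sum_i F i = F i1 + F i2.
Proof. by rewrite big_ord_recl big_ord1; congr (F _ + F _); exact: val_inj. Qed.

(** * Smooth functions and mixed derivatives *)

Section SmoothFunctions.
Variable R : realType.

Lemma smooth_on_differentiable (V W : normedModType R) (U : set V) (f : V -> W) x :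
  smooth_on U f -> U x -> differentiable f x.
Proof. by move=> fU Ux; exact: (fU [::]). Qed.

Lemma smooth_on_derive (V W : normedModType R) (U : set V) (f : V -> W) v :
  smooth_on U f -> smooth_on U ('D_v f).
Proof. by move=> fU s x Ux; have := fU (rcons s v) x Ux; rewrite foldr_rcons. Qed.

Lemma smooth_onS (V W : normedModType R) (U U' : set V) (f : V -> W) :
  U' `<=` U -> smooth_on U f -> smooth_on U' f.
Proof. by move=> U'U fU s x U'x; exact/fU/U'U. Qed.

(** Coinduction: membership in any class of differentiable functions stable under all directional
    derivatives survives iteration. *)
Lemma smooth_on_coind (V W : normedModType R) (U : set V) (P : (V -> W) -> Prop) :
  (forall f x, P f -> U x -> differentiable f x) ->
  (forall f v, P f -> P ('D_v f)) -> forall f, P f -> smooth_on U f.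
Proof.
move=> Pdiff Pder f Pf s; elim/last_ind: s f Pf => [|s v IHs] f Pf x Ux.
  exact: Pdiff.
by rewrite foldr_rcons; exact/IHs/Ux/Pder.
Qed.

Lemma open_eq_near (T : topologicalType) (T' : Type) (U : set T) (f g : T -> T') x :
  open U -> {in U, f =1 g} -> U x -> \near x, f x = g x.
Proof.
move=> oU fg Ux; apply: filterS (open_nbhs_nbhs (conj oU Ux)) => y Uy.
by apply: fg; rewrite inE.
Qed.

Lemma differentiable_near (V W : normedModType R) (f g : V -> W) x :
  (\near x, f x = g x) -> differentiable f x -> differentiable g x.
Proof.
move=> fg df.
have e0 : (\forall h \near (0 : V), f (h + x) = g (h + x)).
  by move: fg; rewrite (near_shift 0) subr0.
have dc := diff_locallyP x f; have [dcont dE] := dc.1 df.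
have E : g \o shift x = cst (g x) + 'd f x +o_ (0 : V) id.
  apply/eqaddoP => _/posnumP[eps].
  have /eqaddoP/(_ _ [gt0 of eps%:num]) := dE.
  apply: filterS2 e0 => h /= eh; rewrite !fctE /=.
  by rewrite eh (nbhs_singleton fg).
apply/diff_locallyP; rewrite (diff_unique dcont E); split => //.
Qed.

(** A class made for [smooth_on_coind]. Differentiating a product, an inverse or a composite yields
    sums of products of the same ingredients, so stability under derivatives can only be proved for
    all constructors together. [SmoothEq] is there because the differentiation rules hold on [U]
    only. *)
Inductive smooth_expr (V : normedModType R) (U : set V) : (V -> R) -> Prop :=
| SmoothBase (f : V -> R) of smooth_on U f : smooth_expr U f
| SmoothCst (c : R) : smooth_expr U (fun=> c)
| SmoothD f g of smooth_expr U f & smooth_expr U g :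
    smooth_expr U (fun x => f x + g x)
| SmoothM f g of smooth_expr U f & smooth_expr U g :
    smooth_expr U (fun x => f x * g x)
| SmoothV f of smooth_expr U f & (forall x, U x -> f x != 0) :
    smooth_expr U (fun x => (f x)^-1)
| SmoothCoord n (f : V -> 'rV[R]_n) i of smooth_on U f :
    smooth_expr U (fun x => f x 0 i)
| SmoothComp n (h : 'rV[R]_n -> R) (f : V -> 'rV[R]_n) of smooth_on setT h & smooth_on U f :
    smooth_expr U (fun x => h (f x))
| SmoothEq f g of {in U, f =1 g} & smooth_expr U f : smooth_expr U g.

End SmoothFunctions.

Section SmoothExpr.
Variables (R : realType) (V : normedModType R) (U : set V).
Hypothesis oU : open U.

Lemma smooth_expr_differentiable f x :
  smooth_expr U f -> U x -> differentiable f x.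
Proof.
move=> + Ux; elim=> {f} [f fU|c|f g _ df _ dg|f g _ df _ dg|f _ df f0|n f i fU
  |n h f hU fU|f g fg _ df].
- exact: smooth_on_differentiable Ux.
- exact: differentiable_cst.
- exact: differentiableD.
- exact: differentiableM.
- by apply: differentiableV => //; exact: f0.
- apply: (@differentiable_comp _ _ _ _ f (fun N : 'rV_n => N 0 i : R)).
    exact: smooth_on_differentiable Ux.
  exact: differentiable_coord.
- apply: differentiable_comp; first exact: smooth_on_differentiable Ux.
  exact: smooth_on_differentiable hU _.
- exact: differentiable_near (open_eq_near oU fg Ux) df.
Qed.

Lemma smooth_expr_sum (I : Type) (r : seq I) (F : I -> V -> R) :
  (forall i, smooth_expr U (F i)) -> smooth_expr U (fun x => \sum_(i <- r) F i x).
Proof.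
move=> FU; elim: r => [|i r IHr].
  by apply: SmoothEq (SmoothCst U 0) => x _; rewrite big_nil.
by apply: SmoothEq (SmoothD (FU i) IHr) => x _; rewrite big_cons.
Qed.

Lemma derive_comp_row n (h : 'rV[R]_n -> R) (f : V -> 'rV[R]_n) x v :
  differentiable f x -> differentiable h (f x) ->
  'D_v (fun x => h (f x)) x =
  \sum_i 'D_(delta_mx 0 i) h (f x) * ('D_v f x) 0 i.
Proof.
move=> df dh; rewrite deriveE; last exact: differentiable_comp.
rewrite (_ : (fun x => _) = h \o f) // diff_comp //= deriveE //.
rewrite [X in 'd _ _ X]row_sum_delta linear_sum; apply: eq_bigr => i _.
by rewrite deriveE // linearZ /= mulrC.
Qed.

Lemma derive_coord n (f : V -> 'rV[R]_n) i x v :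
  derivable f x v -> 'D_v (fun x => f x 0 i) x = ('D_v f x) 0 i.
Proof. by move=> df; rewrite derive_mx // mxE. Qed.

Lemma smooth_expr_derive f v : smooth_expr U f -> smooth_expr U ('D_v f).
Proof.
elim=> {f} [f fU|c|f g fU df gU dg|f g fU df gU dg|f fU df f0|n f i fU
  |n h f hU fU|f g fg _ df].
- exact/SmoothBase/smooth_on_derive.
- by apply: SmoothEq (SmoothCst U 0) => x _; rewrite derive_cst.
- apply: SmoothEq (SmoothD df dg) => x; rewrite inE => Ux.
  by rewrite -deriveD //; apply/diff_derivable/smooth_expr_differentiable.
- apply: SmoothEq (SmoothD (SmoothM fU dg) (SmoothM gU df)) => x; rewrite inE => Ux.
  by rewrite -deriveM //; apply/diff_derivable/smooth_expr_differentiable.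
- have f'U := SmoothV fU f0.
  apply: SmoothEq (SmoothM (SmoothM (SmoothCst U (-1)) (SmoothM f'U f'U)) df) => x.
  rewrite inE => Ux; rewrite deriveV //; last 2 first.
  + exact: f0.
  + exact/diff_derivable/smooth_expr_differentiable.
  by rewrite scaleNr mulN1r mulNr expr2 invfM.
- apply: SmoothEq (SmoothCoord i (smooth_on_derive v fU)) => x; rewrite inE => Ux.
  by rewrite derive_coord //; apply/diff_derivable/smooth_on_differentiable/Ux.
- have F i := SmoothM (SmoothComp (smooth_on_derive (delta_mx 0 i) hU) fU)
    (SmoothCoord i (smooth_on_derive v fU)).
  apply: SmoothEq (smooth_expr_sum _ F) => x; rewrite inE => Ux.
  rewrite derive_comp_row //; first exact: smooth_on_differentiable Ux.
  exact: smooth_on_differentiable hU _.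
- apply: SmoothEq df => x; rewrite inE => Ux.
  exact/near_eq_derive/open_eq_near/Ux.
Qed.

Lemma smooth_exprP f : smooth_expr U f -> smooth_on U f.
Proof.
apply: smooth_on_coind => {}f.
  by move=> x; exact: smooth_expr_differentiable.
by move=> v; exact: smooth_expr_derive.
Qed.

End SmoothExpr.

(** * Symmetry of second directional derivatives *)

Section Schwarz.
Variables (R : realType) (V : normedModType R).

Lemma derive_line (f : V -> R) (x v : V) (t : R) :
  differentiable f (t *: v + x) ->
  is_derive t 1 (fun s : R => f (s *: v + x)) ('D_v f (t *: v + x)).
Proof.
move=> df.
have dl : differentiable (fun s : R => s *: v + x) t by [].
split; first exact/derivable1_diffP/(differentiable_comp dl df).
rewrite deriveE; last exact: (differentiable_comp dl df).
rewrite (_ : (fun s => _) = f \o (fun s : R => s *: v + x)) // diff_comp //=.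
rewrite deriveE //; congr ('d _ _ _).
have -> : 'd (fun s : R => s *: v + x) t = ( *:%R^~ v) + 0 :> (R -> V).
  exact: diff_val.
by rewrite fctE /= scale1r addr0.
Qed.

Definition second_difference (f : V -> R) (x v w : V) (h : R) : R :=
  f (h *: v + (h *: w + x)) - f (h *: v + x) - (f (h *: w + x) - f x).

(** The mean value theorem in direction [v], applied to the difference of [f] along two parallel
    segments, reduces the second difference to two values of ['D_v f]; its differentiability at the
    single point [x] then compares them with an error o(h^2). *)
Lemma second_difference_le (U : set V) (f : V -> R) (x v w : V) (e : R) :
  open U -> U x -> (forall y, U y -> differentiable f y) ->
  differentiable ('D_v f) x -> 0 < e ->
  \forall h \near 0^'+,
    `|second_difference f x v w h - h ^+ 2 * 'D_w ('D_v f) x| <= e * h ^+ 2.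
Proof.
move=> oU Ux df ddf e0.
(* The linearization is used at s v + h w and at s v, with s <= h, so the two errors add up to at
   most e / M * h * (|v| + |w| + |v|). The extra 1 makes [M] positive and the size estimates
   strict. *)
pose M := `|v| + `|w| + `|v| + 1.
have M0 : 0 < M by rewrite ltr_wpDl // !addr_ge0.
have eM0 : 0 < e / M by rewrite divr_gt0.
have /eqaddoP/(_ _ eM0) := diff_locally ddf.
move=> /nbhs_ballP[r /= r0 rP].
have /nbhs_ballP[q /= q0 qU] : nbhs x U by exact: open_nbhs_nbhs.
near=> h.
have h0 : 0 < h by near: h; exact: nbhs_right_gt.
have hM : h * M < Num.min r q.
  rewrite -ltr_pdivlMr //; near: h; apply: nbhs_right_lt.
  by rewrite divr_gt0 // lt_min r0 q0.
have small s t : 0 <= s <= h -> 0 <= t <= h -> `|s *: v + t *: w| <= h * (`|v| + `|w|).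
  move=> /andP[s0 sh] /andP[t0 th]; rewrite (le_trans (ler_normD _ _)) //.
  by rewrite !normrZ !ger0_norm // mulrDr lerD // ler_wpM2r.
have hvw : h * (`|v| + `|w|) < h * M.
  by rewrite ltr_pM2l // /M -[ltRHS]addrA ltrDl ltr_wpDl.
have inU s t : 0 <= s <= h -> 0 <= t <= h -> U (s *: v + (t *: w + x)).
  move=> sh th; apply: qU; rewrite -ball_normE /= addrA opprD addrCA subrr addr0 normrN.
  apply: le_lt_trans (small s t sh th) (lt_trans hvw _).
  by apply: lt_le_trans hM _; rewrite ge_min lexx orbT.
have lin s t : 0 <= s <= h -> 0 <= t <= h ->
    `|'D_v f (s *: v + (t *: w + x)) - 'D_v f x - 'd ('D_v f) x (s *: v + t *: w)|
      <= e / M * `|s *: v + t *: w|.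
  move=> sh th; have := rP (s *: v + t *: w); rewrite -ball_normE /= sub0r normrN.
  rewrite !fctE opprD !addrA; apply.
  apply: le_lt_trans (small s t sh th) (lt_trans hvw _).
  by apply: lt_le_trans hM _; rewrite ge_min lexx.
pose phi s := f (s *: v + (h *: w + x)) - f (s *: v + (0 *: w + x)).
have hh : 0 <= h <= h by apply/andP; split; [exact: ltW | exact: lexx].
have h00 : (0 : R) <= 0 <= h by apply/andP; split; [exact: lexx | exact: ltW].
have dphi s : 0 <= s <= h -> is_derive s 1 phi
    ('D_v f (s *: v + (h *: w + x)) - 'D_v f (s *: v + (0 *: w + x))).
  by move=> sh; apply: is_deriveB; apply: derive_line; apply: df; exact: inU.
have [s|s|s] := @MVT R phi
    (fun s => 'D_v f (s *: v + (h *: w + x)) - 'D_v f (s *: v + (0 *: w + x))) _ _ h0.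
- by rewrite in_itv /= => /andP[/ltW s0 /ltW sh]; apply: dphi; rewrite s0.
- apply: continuous_in_subspaceT => {}s; rewrite inE /= in_itv /= => sh.
  by apply/differentiable_continuous/derivable1_diffP; case: (dphi s sh).
rewrite in_itv /= subr0 => /andP[/ltW s0 /ltW sh] phiE.
have -> : second_difference f x v w h = phi h - phi 0.
  by rewrite /second_difference /phi !scale0r !add0r.
rewrite phiE; have s0h : 0 <= s <= h by rewrite s0.
have := lin s h s0h hh; have := lin s 0 s0h h00.
have dE t : 'd ('D_v f) x (s *: v + t *: w) =
    s * 'd ('D_v f) x v + t * 'd ('D_v f) x w.
  by rewrite linearD !linearZ.
rewrite (deriveE w ddf) !dE scale0r addr0 mul0r addr0.
set A := 'D_v f (s *: v + (h *: w + x)); set B := 'D_v f (s *: v + (_ + x)).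
set dv := 'd _ _ v; set dw := 'd _ _ w => l1 l2.
have -> : (A - B) * h - h ^+ 2 * dw =
    h * ((A - 'D_v f x - (s * dv + h * dw)) - (B - 'D_v f x - s * dv)).
  by ring.
rewrite normrM (gtr0_norm h0).
rewrite [X in _ <= X](_ : _ = h * (e / M * (h * M))); last first.
  by field; rewrite gt_eqF.
rewrite ler_pM2l // (le_trans (ler_normB _ _)) // (le_trans (lerD l2 l1)) //.
rewrite -mulrDr ler_pM2l // normrZ (ger0_norm s0).
have := small s h s0h hh.
have : s * `|v| <= h * `|v| by rewrite ler_wpM2r.
by rewrite /M; nra.
Unshelve. all: by end_near. Qed.

(** The second difference is unchanged when [v] and [w] are exchanged, so h^2 times either mixed
    derivative approximates the same number up to e / 2 * h^2. *)
Lemma derive_comm (U : set V) (f : V -> R) (x v w : V) :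
  open U -> U x -> smooth_on U f -> 'D_v ('D_w f) x = 'D_w ('D_v f) x.
Proof.
move=> oU Ux fU; have df y Uy : differentiable f y := smooth_on_differentiable fU Uy.
have ddf u : differentiable ('D_u f) x.
  exact/smooth_on_differentiable/Ux/smooth_on_derive.
apply/eqP; rewrite -subr_eq0 -normr_le0; apply/ler_addgt0Pl => e e0; rewrite addr0.
have e20 : 0 < e / 2 by rewrite divr_gt0.
have near1 := second_difference_le w oU Ux df (ddf v) e20.
have near2 := second_difference_le v oU Ux df (ddf w) e20.
have near0 : \forall h \near (0 : R)^'+, 0 < h by exact: nbhs_right_gt.
have [h [[H1 H2] h0]] :=
  @filter_ex _ _ (at_right_proper_filter (0 : R)) _ (filterI (filterI near1 near2) near0).
have sdC : second_difference f x w v h = second_difference f x v w h.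
  rewrite /second_difference [h *: w + _]addrCA; ring.
have h20 : 0 < h ^+ 2 by rewrite exprn_gt0.
move: H1 H2; rewrite sdC; move: (second_difference f x v w h) => d.
move: ('D_v ('D_w f) x) ('D_w ('D_v f) x) => A B H1 H2.
rewrite -(ler_pM2l h20) -[X in X * _](gtr0_norm h20) -normrM.
have -> : h ^+ 2 * (A - B) = (d - h ^+ 2 * B) - (d - h ^+ 2 * A) by ring.
by rewrite (le_trans (ler_normB _ _)) // (le_trans (lerD H1 H2)) //
   -mulrDl -splitr mulrC.
Qed.
End Schwarz.

(** * Leibniz and commutation rules for iterated derivatives *)

Section IteratedDerivatives.
Variables (R : realType) (V : normedModType R) (U : set V).
Hypothesis oU : open U.
Implicit Types f g : V -> R.

Definition dir (v : V) f : V -> R := 'D_v f.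

Lemma smooth_on_iter f v n : smooth_on U f -> smooth_on U (iter n (dir v) f).
Proof. by move=> fU; elim: n => //= n; exact: smooth_on_derive. Qed.

Lemma smooth_on_derivable f v x : smooth_on U f -> U x -> derivable f x v.
Proof. by move=> fU Ux; exact/diff_derivable/smooth_on_differentiable/Ux. Qed.

Lemma eq_derive_on f g v : {in U, f =1 g} -> {in U, dir v f =1 dir v g}.
Proof. by move=> fg x; rewrite inE => Ux; exact/near_eq_derive/open_eq_near/Ux. Qed.

Lemma eq_iter_derive_on f g v n :
  {in U, f =1 g} -> {in U, iter n (dir v) f =1 iter n (dir v) g}.
Proof. by move=> fg; elim: n => //= n; exact: eq_derive_on. Qed.

Lemma iter_derive_sum v n (I : Type) (r : seq I) (c : I -> R) (F : I -> V -> R) :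
  (forall i, smooth_on U (F i)) ->
  {in U, iter n (dir v) (fun x => \sum_(i <- r) c i * F i x) =1
    fun x => \sum_(i <- r) c i * iter n (dir v) (F i) x}.
Proof.
move=> FU; elim: n => //= n IHn x xU; rewrite (eq_derive_on _ IHn xU).
move: xU; rewrite inE => Ux.
elim: r {IHn} => [|i r IHr].
  rewrite big_nil (_ : (fun x => _) = fun=> 0) /dir ?derive_cst //.
  by apply/funext => y; rewrite big_nil.
have FnU j : smooth_on U (iter n (dir v) (F j)) := smooth_on_iter v n (FU j).
have cFU j : smooth_on U (fun y => c j * iter n (dir v) (F j) y).
  by apply: (smooth_exprP oU); exact: SmoothM (SmoothCst _ _) (SmoothBase (FnU j)).
have sFU : smooth_on U (fun y => \sum_(i <- r) c i * iter n (dir v) (F i) y).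
  apply/(smooth_exprP oU)/smooth_expr_sum => // j.
  exact: SmoothM (SmoothCst _ _) (SmoothBase (FnU j)).
rewrite big_cons -IHr (_ : (fun y => \sum_(j <- i :: r) _) =
  (fun y => c i * iter n (dir v) (F i) y) +
  (fun y => \sum_(i <- r) c i * iter n (dir v) (F i) y)); last first.
  by apply/funext => y; rewrite big_cons.
rewrite /dir deriveD; [|exact: smooth_on_derivable..].
congr (_ + _); rewrite (_ : (fun y => _) = c i *: iter n (dir v) (F i)) //.
by rewrite /dir deriveZ //; exact: smooth_on_derivable.
Qed.

Lemma iter_deriveM v n f g : smooth_on U f -> smooth_on U g ->
  {in U, iter n (dir v) (fun x => f x * g x) =1 fun x => \sum_(k < n.+1)
    'C(n, k)%:R * (iter k (dir v) f x * iter (n - k) (dir v) g x)}.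
Proof.
elim: n f g => [|n IHn] f g fU gU x xU.
  by rewrite big_ord1 bin0 mul1r.
have Ux : U x by rewrite inE in xU.
have f'U := smooth_on_derive v fU; have g'U := smooth_on_derive v gU.
(* The product rule is phrased as a sum over [bool] to fit [iter_derive_sum]. The innermost
   derivative is the one expanded, so the induction hypothesis applies to f'g and to fg', and
   Pascal's rule recombines them. *)
have dM : {in U, dir v (fun x => f x * g x) =1
    fun x => \sum_(b : bool) 1 * (if b then dir v f x * g x else f x * dir v g x)}.
  move=> y; rewrite inE => Uy; rewrite big_bool /= !mul1r addrC.
  rewrite (_ : (fun x => _) = f * g) // /dir deriveM; [|exact: smooth_on_derivable..].
  by rewrite /GRing.scale /=; ring.
rewrite iterSr (eq_iter_derive_on _ _ dM) //.
rewrite (@iter_derive_sum v n bool (index_enum bool) (fun=> 1)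
  (fun b x => if b then dir v f x * g x else f x * dir v g x)) //; last first.
  move=> b; apply/(smooth_exprP oU).
  by case: b; apply: SmoothM; exact: SmoothBase.
rewrite big_bool /= !mul1r IHn // IHn //.
have gS m h : iter m (dir v) (dir v h) = iter m.+1 (dir v) h by rewrite -iterSr.
rewrite [RHS]big_ord_recl [X in _ + X = _]big_ord_recl !bin0 !subn0 gS addrCA.
congr (_ + _).
under [RHS]eq_bigr => k _.
  rewrite lift0 subSS binS natrD mulrDl; over.
rewrite big_split /= addrC; congr (_ + _).
  rewrite [RHS]big_ord_recr /= bin_small // mul0r addr0.
  apply: eq_bigr => k _; rewrite ?lift0 gS.
  by rewrite subnSK.
by apply: eq_bigr => k _; rewrite gS.
Qed.

Variables e1 e2 : V.

(** The ambient space and the two directions are arbitrary, so that the same rules apply to partial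
    derivatives on the plane and to space derivatives of functions of (t, q). *)
Definition dirs (a b : nat) f : V -> R := iter a (dir e1) (iter b (dir e2) f).

Lemma smooth_on_dirs f a b : smooth_on U f -> smooth_on U (dirs a b f).
Proof. by move=> fU; apply/smooth_on_iter/smooth_on_iter. Qed.

Lemma eq_dirs_on f g a b : {in U, f =1 g} -> {in U, dirs a b f =1 dirs a b g}.
Proof. by move=> fg; apply/eq_iter_derive_on/eq_iter_derive_on. Qed.

Lemma derive_iter f v w n : smooth_on U f ->
  {in U, dir v (iter n (dir w) f) =1 iter n (dir w) (dir v f)}.
Proof.
move=> fU; elim: n => //= n IHn x xU; have Ux : U x by rewrite inE in xU.
rewrite -[RHS](eq_derive_on w IHn xU).
exact: derive_comm oU Ux (smooth_on_iter _ _ fU).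
Qed.

Lemma derive_dirs f w a b : smooth_on U f ->
  {in U, dir w (dirs a b f) =1 dirs a b (dir w f)}.
Proof.
move=> fU x xU; rewrite derive_iter //; last exact: smooth_on_iter.
by apply: eq_iter_derive_on xU; exact: derive_iter.
Qed.

Lemma dirs_derive1 f a b : smooth_on U f -> {in U, dirs a b (dir e1 f) =1 dirs a.+1 b f}.
Proof. by move=> fU x xU; rewrite -derive_dirs. Qed.

Lemma dirs_derive2 f a b : dirs a b (dir e2 f) = dirs a b.+1 f.
Proof. by rewrite /dirs -iterSr. Qed.

Lemma dirs_sum a b (I : Type) (r : seq I) (c : I -> R) (F : I -> V -> R) :
  (forall i, smooth_on U (F i)) ->
  {in U, dirs a b (fun x => \sum_(i <- r) c i * F i x) =1
    fun x => \sum_(i <- r) c i * dirs a b (F i) x}.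
Proof.
move=> FU x xU; rewrite /dirs (eq_iter_derive_on _ _ (iter_derive_sum _ _ _ _ FU)) //.
by rewrite iter_derive_sum // => i; exact: smooth_on_iter.
Qed.

Lemma dirsM a b f g : smooth_on U f -> smooth_on U g ->
  {in U, dirs a b (fun x => f x * g x) =1 fun x =>
    \sum_(c < a.+1) \sum_(d < b.+1) ('C(a, c) * 'C(b, d))%N%:R *
      (dirs c d f x * dirs (a - c) (b - d) g x)}.
Proof.
move=> fU gU x xU; rewrite /dirs (eq_iter_derive_on _ _ (iter_deriveM _ _ fU gU)) //.
have nU d h : smooth_on U h -> smooth_on U (iter d (dir e2) h).
  exact: smooth_on_iter.
rewrite (@iter_derive_sum _ _ _ _ (fun d : 'I_b.+1 => 'C(b, d)%:R)
  (fun d x => iter d (dir e2) f x * iter (b - d) (dir e2) g x)) //; last first.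
  by move=> d; apply: (smooth_exprP oU); apply: SmoothM; exact/SmoothBase/nU.
under eq_bigr => d _ do (rewrite iter_deriveM; [|exact: nU..|exact: xU]; rewrite mulr_sumr).
rewrite exchange_big /=; apply: eq_bigr => c _; apply: eq_bigr => d _.
by rewrite natrM; ring.
Qed.

End IteratedDerivatives.

(** * The derivative of a section along a flow *)

Section Slices.
Variable R : realType.
Local Notation V := (R^o * plane R)%type.

Definition dir_t : V := (1, 0).
Definition dir_x (j : 'I_2) : V := (0, delta_mx 0 j).

Lemma dir_slice (h : V -> R) j t q :
  dir (dir_x j) h (t, q) = partial j (fun q => h (t, q)) q.
Proof.
rewrite /dir /partial /derive.
apply: (f_equal (fun F : R -> R => lim (F @ 0^'))); apply: funext => s /=.
congr (_ *: (h _ - _)); congr pair.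
exact: etrans (congr1 (+%R^~ t) (mulr0 s)) (add0r t).
Qed.

Lemma pderiv_dirs a b (f : plane R -> R) :
  pderiv a b f = dirs (delta_mx 0 i1) (delta_mx 0 i2) a b f.
Proof. by []. Qed.

Lemma dirs_slice a b (h : V -> R) t q :
  dirs (dir_x i1) (dir_x i2) a b h (t, q) = pderiv a b (fun q => h (t, q)) q.
Proof.
have sl2 : forall q, iter b (dir (dir_x i2)) h (t, q) =
    iter b (partial i2) (fun q => h (t, q)) q.
  elim: b => [//|b IHb] q'; rewrite !iterS dir_slice; congr (partial _ _ q').
  exact/funext.
rewrite /dirs /pderiv; elim: a q => [//|a IHa] q; rewrite !iterS dir_slice.
congr (partial _ _ q); exact/funext.
Qed.

End Slices.

Section Cubic.
Variable R : realType.

(* The coefficients in [t] of the cubic defining [f^(0)], where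
   [A = a + a' t], [B = b + b' t] and [Q^k = pk + 2 qk t + rk t^2]. *)
Definition cubic_coef (s : 'I_4 -> R) (a a' b b' p1 q1 r1 p2 q2 r2 j : R)
    (k : 'I_4) : R :=
  let s0 := s (@Ordinal 4 0 isT) in let s1 := s (@Ordinal 4 1 isT) in
  let s2 := s (@Ordinal 4 2 isT) in let s3 := s (@Ordinal 4 3 isT) in
  j * (match val k with
  | 0 => s0 * (a * a * a) + s1 * (b * a * a) + s2 * (b * b * a) + s3 * (b * b * b)
         - a * p2 + b * p1
  | 1 => s0 * (3 * (a * a * a')) + s1 * (b' * a * a + 2 * (b * a * a'))
         + s2 * (a' * b * b + 2 * (a * b * b')) + s3 * (3 * (b * b * b'))
         - (a' * p2 + 2 * (a * q2)) + (b' * p1 + 2 * (b * q1))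
  | 2 => s0 * (3 * (a * a' * a')) + s1 * (b * a' * a' + 2 * (b' * a * a'))
         + s2 * (a * b' * b' + 2 * (a' * b * b')) + s3 * (3 * (b * b' * b'))
         - (a * r2 + 2 * (a' * q2)) + (b * r1 + 2 * (b' * q1))
  | _ => s0 * (a' * a' * a') + s1 * (b' * a' * a') + s2 * (b' * b' * a')
         + s3 * (b' * b' * b') - a' * r2 + b' * r1
  end).

Lemma cubic_coefE (s : 'rV[R]_4) (a a' b b' p1 q1 r1 p2 q2 r2 j : R) (k : 'I_4) :
  (j *: (\sum_(i < 4) s 0 i *: ((b%:P + b' *: 'X) ^+ i * (a%:P + a' *: 'X) ^+ (3 - i))
     - (a%:P + a' *: 'X) * (p2%:P + (2 * q2) *: 'X + r2 *: 'X^2)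
     + (b%:P + b' *: 'X) * (p1%:P + (2 * q1) *: 'X + r1 *: 'X^2)))`_k =
  cubic_coef (s 0) a a' b b' p1 q1 r1 p2 q2 r2 j k.
Proof.
pose c i : R := cubic_coef (s 0) a a' b b' p1 q1 r1 p2 q2 r2 j i.
set P := _ *: _; suff -> : P = \poly_(i < 4) c (inord i).
  by rewrite coef_poly ltn_ord inord_val.
rewrite poly_def !big_ord_recl !big_ord0 /P !big_ord_recl !big_ord0.
have inE i (lti : (i < 4)%N) : inord i = Ordinal lti by apply: val_inj; rewrite /= inordK.
rewrite /= /bump /= !add1n !inE /c /cubic_coef /=.
have -> : lift (@ord0 3) (lift ord0 (lift ord0 ord0)) = @Ordinal 4 3 isT.
  exact: val_inj.
have -> : lift (@ord0 3) (lift ord0 ord0) = @Ordinal 4 2 isT by exact: val_inj.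
have -> : lift (@ord0 3) ord0 = @Ordinal 4 1 isT by exact: val_inj.
have -> : @ord0 3 = @Ordinal 4 0 isT by exact: val_inj.
move: (s 0 (@Ordinal 4 0 isT)) (s 0 (@Ordinal 4 1 isT)) (s 0 (@Ordinal 4 2 isT))
  (s 0 (@Ordinal 4 3 isT)) => s0 s1 s2 s3.
rewrite -!mul_polyC !(polyCD, polyCM, polyCN, polyC_natr).
ring.
Qed.

End Cubic.

(* Infinitesimally, the lift of [X] acts on sections by
   [u^k |-> Psi^k(X^i_j, X^i_jl, u) - X^j u^k_j], where [Psi] is affine in [u];
   [lie_terms k] lists its coefficients, [Transport j] standing for [X^j u^k_j].
   It is read either as a function ([lie_fun]) or on jets ([lie_jet]). *)
Inductive lie_term :=
  | Second of 'I_2 & 'I_2 & 'I_2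
  | First of 'I_2 & 'I_2 & 'I_4
  | Transport of 'I_2.

Section LieTerms.
Variable R : realType.

Local Notation j0 := (@Ordinal 4 0 isT).
Local Notation j1 := (@Ordinal 4 1 isT).
Local Notation j2 := (@Ordinal 4 2 isT).
Local Notation j3 := (@Ordinal 4 3 isT).

Definition lie_terms (k : 'I_4) : seq (R * lie_term) :=
  (match val k with
  | 0 => [:: (1, Second i2 i1 i1); (1, First i2 i2 j0); (- 2, First i1 i1 j0);
             (- 1, First i2 i1 j1)]
  | 1 => [:: (2, Second i2 i1 i2); (- 1, Second i1 i1 i1); (- 1, First i1 i1 j1);
             (- 2, First i2 i1 j2); (- 3, First i1 i2 j0)]
  | 2 => [:: (1, Second i2 i2 i2); (- 2, Second i1 i1 i2); (- 1, First i2 i2 j2);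
             (- 3, First i2 i1 j3); (- 2, First i1 i2 j1)]
  | _ => [:: (- 1, Second i1 i2 i2); (1, First i1 i1 j3); (- 2, First i2 i2 j3);
             (- 1, First i1 i2 j2)]
  end) ++ [:: (- 1, Transport i1); (- 1, Transport i2)].

Definition lie_term_fun (X : plane R -> plane R) (S : plane R -> fibre R) (k : 'I_4)
    (t : lie_term) : plane R -> R :=
  match t with
  | Second i j l => partial j (partial l (fun q => X q 0 i))
  | First i j m => fun q => partial j (fun q => X q 0 i) q * S q 0 m
  | Transport j => fun q => X q 0 j * partial j (fun q => S q 0 k) q
  end.

Definition lie_fun X S (k : 'I_4) (q : plane R) : R :=
  \sum_(t <- lie_terms k) t.1 * lie_term_fun X S k t.2 q.

(** Jets are handled here as arrays indexed by all pairs of orders. Truncation then never interferes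
    with an identity, and the order of a jet reappears only as a bound on a + b. *)
Definition leibniz (F G : nat -> nat -> R) (a b : nat) : R :=
  \sum_(c < a.+1) \sum_(d < b.+1)
    ('C(a, c) * 'C(b, d))%N%:R * (F c d * G (a - c)%N (b - d)%N).

Definition shift (j : 'I_2) (F : nat -> nat -> R) (a b : nat) : R :=
  F (a + (j == i1))%N (b + (j == i2))%N.

Definition lie_term_jet (X : 'I_2 -> nat -> nat -> R) (u : 'I_4 -> nat -> nat -> R)
    (k : 'I_4) (t : lie_term) : nat -> nat -> R :=
  match t with
  | Second i j l => shift j (shift l (X i))
  | First i j m => leibniz (shift j (X i)) (u m)
  | Transport j => leibniz (X j) (shift j (u k))
  end.

Definition lie_jet X u (k : 'I_4) (a b : nat) : R :=
  \sum_(t <- lie_terms k) t.1 * lie_term_jet X u k t.2 a b.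

Definition taylor n (F : plane R -> 'rV[R]_n) (p : plane R) (i : 'I_n) (a b : nat) : R :=
  pderiv a b (fun q => F q 0 i) p.

Let oT : open [set: plane R] := openT.

Lemma smooth_coord n (F : plane R -> 'rV[R]_n) i :
  smooth_on setT F -> smooth_on setT (fun q => F q 0 i).
Proof. by move=> FT; apply: (smooth_exprP oT); exact: SmoothCoord. Qed.

Lemma smooth_pderiv a b (h : plane R -> R) :
  smooth_on setT h -> smooth_on setT (pderiv a b h).
Proof. by move=> hT; rewrite pderiv_dirs; exact: smooth_on_dirs. Qed.

Lemma smooth_partial j (h : plane R -> R) :
  smooth_on setT h -> smooth_on setT (partial j h).
Proof. exact: smooth_on_derive. Qed.

Lemma pderiv_partial j a b (h : plane R -> R) : smooth_on setT h ->
  pderiv a b (partial j h) = pderiv (a + (j == i1)) (b + (j == i2)) h.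
Proof.
move=> hT; rewrite !pderiv_dirs; case: j => -[|[|//]] lt2.
  have -> : Ordinal lt2 = i1 by exact: val_inj.
  rewrite addn1 addn0; apply/funext => q.
  by apply: (dirs_derive1 oT) => //; rewrite inE.
have -> : Ordinal lt2 = i2 by exact: val_inj.
by rewrite addn1 addn0 -dirs_derive2.
Qed.

Lemma partial_pderiv j a b (h : plane R -> R) : smooth_on setT h ->
  partial j (pderiv a b h) = pderiv a b (partial j h).
Proof.
move=> hT; apply/funext => q; rewrite !pderiv_dirs.
by apply: (derive_dirs oT) => //; rewrite inE.
Qed.

Lemma pderivM a b (g h : plane R -> R) p : smooth_on setT g -> smooth_on setT h ->
  pderiv a b (fun q => g q * h q) p =
  leibniz (fun a b => pderiv a b g p) (fun a b => pderiv a b h p) a b.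
Proof. by move=> gT hT; rewrite !pderiv_dirs (dirsM oT) // inE. Qed.

Lemma smooth_lie_term_fun X S k t : smooth_on setT X -> smooth_on setT S ->
  smooth_on setT (lie_term_fun X S k t).
Proof.
move=> XT ST; have Xi i := smooth_coord i XT; have Si i := smooth_coord i ST.
case: t => [i j l|i j m|j] /=.
- exact/smooth_partial/smooth_partial.
- apply: (smooth_exprP oT); apply: SmoothM; apply: SmoothBase => //.
  exact/smooth_partial.
- apply: (smooth_exprP oT); apply: SmoothM; apply: SmoothBase => //.
  exact/smooth_partial.
Qed.

Lemma pderiv_lie_fun X S k a b p : smooth_on setT X -> smooth_on setT S ->
  pderiv a b (lie_fun X S k) p = lie_jet (taylor X p) (taylor S p) k a b.
Proof.
move=> XT ST; have Xi i := smooth_coord i XT; have Si i := smooth_coord i ST.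
rewrite pderiv_dirs /lie_fun (dirs_sum oT) ?inE //; last first.
  by move=> t; exact: smooth_lie_term_fun.
apply: eq_bigr => -[c t] _; rewrite -pderiv_dirs /=; congr (_ * _).
case: t => [i j l|i j m|j] /=.
- by rewrite pderiv_partial ?pderiv_partial //; exact: smooth_partial.
- rewrite pderivM //; last exact: smooth_partial.
  congr (leibniz _ _ a b); apply/funext => a1; apply/funext => b1.
  by rewrite pderiv_partial.
- rewrite pderivM //; last exact: smooth_partial.
  congr (leibniz _ _ a b); apply/funext => a1; apply/funext => b1.
  by rewrite pderiv_partial.
Qed.

End LieTerms.

Section Dual.
Variables (R : realType) (V : normedModType R).

(** Forward differentiation with dual numbers a + a' eps: value and derivative along [v] are
    propagated together through the formula of the lift. *)
Definition dual (h : V -> R) (z v : V) (a a' : R) := h z = a /\ is_derive z v h a'.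

Lemma dual_cst c z v : dual (fun=> c) z v c 0.
Proof. by split=> //; exact: is_derive_cst. Qed.

Lemma dualD f g z v a a' b b' : dual f z v a a' -> dual g z v b b' ->
  dual (fun z => f z + g z) z v (a + b) (a' + b').
Proof. by move=> [<- df] [<- dg]; split=> //; exact: is_deriveD. Qed.

Lemma dualN f z v a a' : dual f z v a a' -> dual (fun z => - f z) z v (- a) (- a').
Proof. by move=> [<- df]; split=> //; exact: is_deriveN. Qed.

Lemma dualM f g z v a a' b b' : dual f z v a a' -> dual g z v b b' ->
  dual (fun z => f z * g z) z v (a * b) (a * b' + a' * b).
Proof.
move=> [<- df] [<- dg]; split=> //.
by apply: is_derive_eq (is_deriveM df dg) _; rewrite /GRing.scale /= (mulrC a').
Qed.

Lemma dualV f z v a' : dual f z v 1 a' -> dual (fun z => (f z)^-1) z v 1 (- a').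
Proof.
move=> [fz [df <-]]; split; first by rewrite fz invr1.
have f0 : f z != 0 by rewrite fz oner_eq0.
split; first exact: derivableV.
by rewrite deriveV // fz expr1n invr1 scaleN1r.
Qed.

Lemma dual_derive f z v a a' b : dual f z v a a' -> a' = b -> dir v f z = b.
Proof. by move=> [_ [_ <-]]. Qed.

End Dual.

Section Flow.
Variables (R : realType) (X : plane R -> plane R) (S : plane R -> fibre R).
Variables (f : R -> plane R -> plane R) (U : set (plane R)) (e : R).
Hypotheses (XT : smooth_on setT X) (ST : smooth_on setT S).
Hypotheses (oU : open U) (e0 : 0 < e).
Local Notation V := (R^o * plane R)%type.
Hypothesis f_smooth :
  smooth_on [set z : R^o * plane R | `|z.1| < e /\ U z.2] (fun z => f z.1 z.2).
Hypothesis f_id : forall x, U x -> f 0 x = x.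
Hypothesis f_der : forall t x, `|t| < e -> U x ->
  is_derive (t : R^o) (1 : R^o) (fun s : R^o => f s x) (X (f t x)).
Hypothesis f_add : forall s t x, `|s| < e -> `|t| < e -> `|s + t| < e ->
  U x -> U (f t x) -> f s (f t x) = f (s + t) x.

Let cyl : set V := [set z | `|z.1| < e /\ U z.2].
Let G (z : V) : plane R := f (- z.1) z.2.

Lemma open_cyl : open cyl.
Proof.
apply: openI.
  apply: (@open_comp _ _ (fun z : V => `|z.1|) [set r : R | r < e]).
    move=> z _; apply: (@continuous_comp _ _ _ (fst : V -> R^o) (fun r => `|r|)).
      exact: cvg_fst.
    exact: norm_continuous.
  exact: open_lt.
apply: (@open_comp _ _ (snd : V -> plane R) U) => // z _; exact: cvg_snd.
Qed.

Lemma cyl0 q : U q -> cyl (0, q).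
Proof. by move=> Uq; split => //=; rewrite normr0. Qed.

Let refl (z : V) : V := (- z.1, z.2).

Lemma differentiable_refl z : differentiable refl z.
Proof.
apply: differentiable_pair.
  apply: (@differentiableN _ V R^o (fst : V -> R^o)).
  by apply: linear_differentiable => {}z; exact: cvg_fst.
by apply: linear_differentiable => {}z; exact: cvg_snd.
Qed.

Lemma derive_refl (h : V -> plane R) v : 'D_v (h \o refl) = 'D_(refl v) h \o refl.
Proof.
apply/funext => z; rewrite /derive /=.
apply: (f_equal (fun F : R -> plane R => lim (F @ 0^'))); apply: funext => s /=.
congr (_ *: (h _ - _)); rewrite /refl /=; congr pair.
exact: etrans (opprD _ _) (congr1 (+%R^~ (- z.1)) (esym (mulrN s v.1))).
Qed.

Lemma smooth_G : smooth_on cyl G.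
Proof.
have reflU z : cyl z -> cyl (refl z) by move=> [z1 z2]; split=> //=; rewrite normrN.
apply: (@smooth_on_coind _ _ _ _
  (fun h => exists2 g, smooth_on cyl g & h = g \o refl)) => [h x [g gU ->] Ux|h v [g gU ->]|].
- apply: differentiable_comp; first exact: differentiable_refl.
  by apply: smooth_on_differentiable gU _; exact: reflU.
- exists ('D_(refl v) g); first exact: smooth_on_derive.
  exact: derive_refl.
- by exists (fun z => f z.1 z.2).
Qed.

Lemma G0 q : U q -> G (0, q) = q.
Proof. by move=> Uq; rewrite /G /= oppr0 f_id. Qed.

Let g i (z : V) : R := G z 0 i.
Let dg i j : V -> R := dir (dir_x R j) (g i).
Let ddg i j k : V -> R := dir (dir_x R j) (dir (dir_x R k) (g i)).
Let jac (z : V) := dg i1 i1 z * dg i2 i2 z - dg i1 i2 z * dg i2 i1 z.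

Lemma smooth_g i : smooth_on cyl (g i).
Proof. by apply: (smooth_exprP open_cyl); apply: SmoothCoord; exact: smooth_G. Qed.

Lemma smooth_dg i j : smooth_on cyl (dg i j).
Proof. exact/smooth_on_derive/smooth_g. Qed.

Lemma smooth_ddg i j k : smooth_on cyl (ddg i j k).
Proof. exact/smooth_on_derive/smooth_on_derive/smooth_g. Qed.

Lemma smooth_jac : smooth_on cyl jac.
Proof.
have B i j := SmoothBase (smooth_dg i j).
apply: (smooth_exprP open_cyl).
apply: SmoothEq (SmoothD (SmoothM (B i1 i1) (B i2 i2))
  (SmoothM (SmoothCst _ (-1)) (SmoothM (B i1 i2) (B i2 i1)))) => z _.
by rewrite mulN1r.
Qed.

Lemma dir_et_g i q : U q -> dir (dir_t R) (g i) (0, q) = - X q 0 i.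
Proof.
move=> Uq.
rewrite /dir derive_coord; last first.
  exact/diff_derivable/(smooth_on_differentiable smooth_G)/cyl0.
have -> : 'D_(dir_t R) G (0, q) =
    'D_(refl (dir_t R)) (fun z : V => f z.1 z.2) (refl (0, q)).
  exact: (congr1 (@^~ (0, q)) (derive_refl (fun z : V => f z.1 z.2) (dir_t R))).
have -> : refl (0, q) = (0, q) by rewrite /refl /= oppr0.
have df := smooth_on_differentiable f_smooth (cyl0 Uq).
have -> : refl (dir_t R) = - dir_t R.
  exact: (congr1 (fun y : plane R => (- 1 : R^o, y)) (esym (oppr0 _))).
rewrite deriveE // linearN /= -deriveE // mxE; congr (- (_ : plane R) 0 i).
have := f_der (t := 0) (x := q); rewrite normr0 f_id // => /(_ e0 Uq) [_ <-].
rewrite /derive.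
apply: (f_equal (fun F : R -> plane R => lim (F @ 0^'))); apply: funext => s /=.
congr (_ *: (f _ _ - _)).
by rewrite scaler0 add0r.
Qed.

Lemma partial_proj i j q : partial j (fun q => q 0 i) q = (i == j)%:R :> R.
Proof.
rewrite /partial derive_coord; last exact: derivable_id.
by rewrite derive_id mxE eqxx eq_sym.
Qed.

Lemma near_partial (h k : plane R -> R) j q : {in U, h =1 k} -> U q ->
  partial j h q = partial j k q.
Proof. by move=> hk Uq; exact/near_eq_derive/(open_eq_near oU hk). Qed.

Lemma g_slice i : {in U, (fun q => g i (0, q)) =1 (fun q => q 0 i)}.
Proof. by move=> q; rewrite inE => Uq; rewrite /g G0. Qed.

Lemma dg_slice i j : {in U, (fun q => dg i j (0, q)) =1 (fun=> (i == j)%:R)}.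
Proof.
move=> q; rewrite inE => Uq; rewrite /dg dir_slice.
by rewrite (near_partial _ (@g_slice i)) // partial_proj.
Qed.

Lemma ddg_slice i j k q : U q -> ddg i j k (0, q) = 0.
Proof.
move=> Uq; rewrite /ddg dir_slice (near_partial _ (@dg_slice i k)) //.
exact: derive_cst.
Qed.

Lemma is_derive_smooth (h : V -> R) (O : set V) z v : smooth_on O h -> O z ->
  is_derive z v h (dir v h z).
Proof. by move=> hO Oz; exact/derivableP/diff_derivable/smooth_on_differentiable/Oz. Qed.

(** Time and space derivatives commute, so the time derivative of d_j g^i at t = 0 is d_j of the
    velocity - X^i. *)
Lemma dual_dg i j q : U q ->
  dual (dg i j) (0, q) (dir_t R) (i == j)%:R (- partial j (fun q => X q 0 i) q).
Proof.
move=> Uq; have Cq := cyl0 Uq; split; first by rewrite dg_slice ?inE.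
have -> : - partial j (fun q => X q 0 i) q = dir (dir_t R) (dg i j) (0, q).
  have -> : dir (dir_t R) (dg i j) (0, q) = dir (dir_x R j) (dir (dir_t R) (g i)) (0, q).
    exact: derive_comm open_cyl Cq (smooth_g i).
  rewrite dir_slice.
  rewrite (@near_partial (fun q => dir (dir_t R) (g i) (0, q))
    (fun q => - X q 0 i)) //; last first.
    by move=> q1; rewrite inE => Uq1; exact: dir_et_g.
  rewrite /partial -deriveN //.
  by apply: smooth_on_derivable (smooth_coord i XT) _.
exact: is_derive_smooth (smooth_dg i j) Cq.
Qed.

Lemma dual_ddg i j k q : U q -> dual (ddg i j k) (0, q) (dir_t R) 0
  (- partial j (partial k (fun q => X q 0 i)) q).
Proof.
move=> Uq; have Cq := cyl0 Uq; split; first by rewrite ddg_slice.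
have -> : - partial j (partial k (fun q => X q 0 i)) q =
    dir (dir_t R) (ddg i j k) (0, q).
  have -> : dir (dir_t R) (ddg i j k) (0, q) = dir (dir_x R j) (dir (dir_t R) (dg i k)) (0, q).
    exact: derive_comm open_cyl Cq (smooth_dg i k).
  rewrite dir_slice.
  rewrite (@near_partial (fun q => dir (dir_t R) (dg i k) (0, q))
    (fun q => - partial k (fun q => X q 0 i) q)) //; last first.
    by move=> q1; rewrite inE => Uq1; case: (dual_dg i k Uq1) => _ [_ <-].
  rewrite /partial -deriveN //.
  by apply: smooth_on_derivable (smooth_partial k (smooth_coord i XT)) _.
exact: is_derive_smooth (smooth_ddg i j k) Cq.
Qed.

Lemma dual_SG k q : U q -> dual (fun z => S (G z) 0 k) (0, q) (dir_t R) (S q 0 k)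
  (- (X q 0 i1 * partial i1 (fun q => S q 0 k) q +
      X q 0 i2 * partial i2 (fun q => S q 0 k) q)).
Proof.
move=> Uq; have Cq := cyl0 Uq; split; first by rewrite G0.
have Sk := smooth_coord k ST.
set F := fun z => _; have FU : smooth_on cyl F.
  by apply: (smooth_exprP open_cyl); apply: SmoothComp Sk smooth_G.
suff <- : dir (dir_t R) F (0, q) = - (X q 0 i1 * partial i1 (fun q => S q 0 k) q +
      X q 0 i2 * partial i2 (fun q => S q 0 k) q) by exact: is_derive_smooth FU Cq.
rewrite /dir /F (derive_comp_row _ (h := fun q => S q 0 k)); last 2 first.
- exact: smooth_on_differentiable smooth_G Cq.
- exact: smooth_on_differentiable Sk _.
rewrite G0 // sum2E.
have E i : ('D_(dir_t R) G (0, q)) 0 i = - X q 0 i.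
  rewrite -dir_et_g // /dir derive_coord //.
  exact/diff_derivable/(smooth_on_differentiable smooth_G).
by rewrite !E /partial; ring.
Qed.


(** On [O] the group law gives f_t (f_{-t} q) = q and the Jacobian is invertible, which is what the
    explicit formula of the lift requires. It is open and contains the slice t = 0 over [U]. *)
Let O : set V := [set z | [/\ cyl z, U (G z) & jac z != 0]].

Lemma open_O : open O.
Proof.
rewrite openE => z [Cz UGz jz].
have cG : {for z, continuous G}.
  exact/differentiable_continuous/(smooth_on_differentiable smooth_G).
have cj : {for z, continuous jac}.
  exact/differentiable_continuous/(smooth_on_differentiable smooth_jac).
have C1 : nbhs z cyl by apply: open_nbhs_nbhs; split => //; exact: open_cyl.
have C2 : nbhs z (G @^-1` U) by apply: cG; exact: open_nbhs_nbhs.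
have C3 : nbhs z (jac @^-1` [set r | r != 0]).
  by apply: cj; apply: open_nbhs_nbhs; split => //; exact: open_neq.
by apply: filterS (filterI C1 (filterI C2 C3)) => z1 [? [? ?]]; split.
Qed.

Lemma O_cyl : O `<=` cyl. Proof. by move=> z []. Qed.

Lemma O0 q : U q -> O (0, q).
Proof.
move=> Uq; split; [exact: cyl0 | by rewrite G0 |].
by rewrite /jac !dg_slice ?inE //= mulr0 subr0 mulr1 oner_eq0.
Qed.

(** The transformed section written out as an expression in derivatives of the inverse flow: [tau]
    agrees with it on [O], and unlike [tau] it is visibly smooth in t and q jointly. *)
Let T k z : R := cubic_coef (fun m => S (G z) 0 m) (dg i1 i1 z) (dg i1 i2 z)
  (dg i2 i1 z) (dg i2 i2 z) (ddg i1 i1 i1 z) (ddg i1 i1 i2 z) (ddg i1 i2 i2 z)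
  (ddg i2 i1 i1 z) (ddg i2 i1 i2 z) (ddg i2 i2 i2 z) (jac z)^-1 k.

Let tau k (z : V) : R := transform_section (f z.1) (f (- z.1)) S z.2 0 k.

Lemma tau_T k : {in O, tau k =1 T k}.
Proof.
move=> [t q]; rewrite inE => -[[/= te Uq] UG _].
have fq : f t (f (- t) q) = q.
  by rewrite f_add ?normrN // subrr ?f_id ?normr0.
have dgE i j : dg i j (t, q) = partial j (fun y => f (- t) y 0 i) q.
  exact: dir_slice.
have ddgE i j l : ddg i j l (t, q) =
    partial j (partial l (fun y => f (- t) y 0 i)) q.
  rewrite /ddg dir_slice; congr (partial j _ q); apply: funext => y.
  exact: dir_slice.
rewrite /tau /transform_section /point_lift /= fq mxE cubic_coefE.
by rewrite /T /jac !dgE !ddgE.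
Qed.

Let SmoothN (W : set V) h : smooth_expr W h -> smooth_expr W (fun z => - h z).
Proof.
by move=> hW; apply: SmoothEq (SmoothM (SmoothCst W (-1)) hW) => z _; rewrite mulN1r.
Qed.

Lemma smooth_T k : smooth_on O (T k).
Proof.
have A i j := SmoothBase (smooth_onS O_cyl (smooth_dg i j)).
have B i j l := SmoothBase (smooth_onS O_cyl (smooth_ddg i j l)).
have C m := SmoothComp (smooth_coord m ST) (smooth_onS O_cyl smooth_G).
have J : smooth_expr O (fun z => (jac z)^-1).
  by apply: SmoothV; [exact/SmoothBase/(smooth_onS O_cyl smooth_jac) | move=> z []].
apply: (smooth_exprP open_O); rewrite /T /cubic_coef.
by case: k => -[|[|[|[|//]]]] lt4 /=; apply: SmoothM => //;
  repeat match goal with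
  | |- smooth_expr _ (fun z => _ * _) => apply: SmoothM
  | |- smooth_expr _ (fun z => _ + _) => apply: SmoothD
  | |- smooth_expr _ (fun z => - _) => apply: SmoothN
  | |- smooth_expr _ (ddg ?i ?j ?l) => exact: (B i j l)
  | |- smooth_expr _ (dg ?i ?j) => exact: (A i j)
  | |- smooth_expr _ (fun z => S _ _ _) => exact: C
  | |- _ => exact: SmoothCst
  end.
Qed.

Lemma T_slice k q : U q -> T k (0, q) = S q 0 k.
Proof.
move=> Uq; have E i j : dg i j (0, q) = (i == j)%:R by rewrite dg_slice ?inE.
have J : jac (0, q) = 1 by rewrite /jac !E /=; ring.
rewrite /T /cubic_coef J !E !ddg_slice // G0 //.
by case: k => -[|[|[|[|//]]]] lt4 /=; rewrite (bool_irrelevance lt4 isT) invr1; ring.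
Qed.

Lemma derive_T k q : U q -> dir (dir_t R) (T k) (0, q) = lie_fun X S k q.
Proof.
move=> Uq; have A i j := dual_dg i j Uq; have B i j l := dual_ddg i j l Uq.
have C m := dual_SG m Uq.
(* Derivatives are replaced by opaque constants, so that the final comparison is a polynomial
   identity for [ring]. *)
have [x1 x1E] : exists x1, forall i j, partial j (fun q => X q 0 i) q = x1 i j.
  by exists (fun i j => partial j (fun q => X q 0 i) q).
have [x2 x2E] : exists x2, forall i j l,
    partial j (partial l (fun q => X q 0 i)) q = x2 i j l.
  by exists (fun i j l => partial j (partial l (fun q => X q 0 i)) q).
have [s1 s1E] : exists s1, forall m j, partial j (fun q => S q 0 m) q = s1 m j.
  by exists (fun m j => partial j (fun q => S q 0 m) q).
have {}A i j : dual (dg i j) (0, q) (dir_t R) (i == j)%:R (- x1 i j) by rewrite -x1E.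
have {}B i j l : dual (ddg i j l) (0, q) (dir_t R) 0 (- x2 i j l) by rewrite -x2E.
have {}C m : dual (fun z => S (G z) 0 m) (0, q) (dir_t R) (S q 0 m)
    (- (X q 0 i1 * s1 m i1 + X q 0 i2 * s1 m i2)) by rewrite -!s1E.
have J : dual (fun z => (jac z)^-1) (0, q) (dir_t R) 1 (x1 i1 i1 + x1 i2 i2).
  have := dualD (dualM (A i1 i1) (A i2 i2)) (dualN (dualM (A i1 i2) (A i2 i1))).
  rewrite /= mulr0 subr0 mulr1 => /dualV; congr dual.
  by ring.
have -> : lie_fun X S k q = \sum_(t <- lie_terms R k) t.1 * match t.2 with
    | Second i j l => x2 i j l
    | First i j m => x1 i j * S q 0 m
    | Transport j => X q 0 j * s1 k j
    end.
  by apply: eq_bigr => -[c [i j l|i j m|j]] _ /=; rewrite ?x2E ?x1E ?s1E.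
have [s sE] : exists s, forall m, S q 0 m = s m by exists (S q 0).
have [x xE] : exists x, forall i, X q 0 i = x i by exists (X q 0).
rewrite /T /cubic_coef.
case: k => -[|[|[|[|//]]]] lt4; rewrite (bool_irrelevance lt4 isT) /=;
  (apply: dual_derive; [repeat match goal with
  | |- dual (fun z => _ * _) _ _ _ _ => apply: dualM
  | |- dual (fun z => _ + _) _ _ _ _ => apply: dualD
  | |- dual (fun z => - _) _ _ _ _ => apply: dualN
  | |- dual (ddg ?i ?j ?l) _ _ _ _ => exact: (B i j l)
  | |- dual (dg ?i ?j) _ _ _ _ => exact: (A i j)
  | |- dual (fun z => fun_of_matrix _ _ ?m) _ _ _ _ => exact: (C m)
  | |- dual (fun z => (jac z)^-1) _ _ _ _ => exact: J
  | |- _ => exact: dual_cst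
  end |]);
  rewrite /lie_terms /= !big_cons big_nil /= !sE !xE; ring.
Qed.

Lemma pderiv_near a b (h1 h2 : plane R -> R) q : {in U, h1 =1 h2} -> U q ->
  pderiv a b h1 q = pderiv a b h2 q.
Proof. by move=> h12 Uq; rewrite !pderiv_dirs (eq_dirs_on oU _ _ _ _ h12) // inE. Qed.

(** The jet is taken at the moving point f_t(p), so the chain rule runs along t |-> (t, f_t(p)), of
    velocity (1, X(p)). The time part gives the jet of [lie_fun], the space part the terms X^j
    u_{sigma + j}. *)
Lemma flow_derive k a b p : U p ->
  is_derive (0 : R^o) (1 : R^o)
    (fun t : R^o => pderiv a b
      (fun q => transform_section (f t) (f (- t)) S q 0 k) (f t p) : R^o)
    (pderiv a b (lie_fun X S k) p +
      \sum_j X p 0 j * pderiv (a + (j == i1)) (b + (j == i2)) (fun q => S q 0 k) p).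
Proof.
move=> Up; pose h := dirs (dir_x R i1) (dir_x R i2) a b (T k).
have hO : smooth_on O h by apply: smooth_on_dirs; exact: smooth_T.
have Op := O0 Up.
have dh : differentiable h (0, p) := smooth_on_differentiable hO Op.
pose c (t : R^o) : V := (t, f t p).
have fp : is_derive (0 : R^o) (1 : R^o) (fun s : R^o => f s p) (X p).
  by have := f_der (t := 0) (x := p); rewrite normr0 f_id //; apply.
have dfp : differentiable (fun s : R^o => f s p) (0 : R^o).
  by apply/derivable1_diffP; case: fp.
have dc : differentiable c (0 : R^o) by apply: differentiable_pair.
have c0 : c 0 = (0, p) by rewrite /c f_id.
have dc1 : 'd c (0 : R^o) (1 : R^o) = (1, X p).
  rewrite /c diff_pair //; congr pair; first by rewrite diff_val.
  by rewrite -deriveE //; case: fp.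
have hE : {in O, h =1 dirs (dir_x R i1) (dir_x R i2) a b (tau k)}.
  move=> z zO; apply: (eq_dirs_on open_O _ _ _ _ _ zO) => {zO}z zO.
  by rewrite tau_T.
apply: (@near_eq_is_derive _ _ _ (h \o c)).
  have : nbhs (0 : R^o) (c @^-1` O).
    apply: (differentiable_continuous dc); apply: open_nbhs_nbhs.
    by rewrite c0; split => //; exact: open_O.
  apply: filterS => t Ot; rewrite /= hE ?inE //; exact: dirs_slice.
have dhc : differentiable (h \o c) (0 : R^o).
  by apply: differentiable_comp => //; rewrite c0.
split; first exact/derivable1_diffP.
rewrite deriveE // diff_comp ?c0 //= dc1.
have -> : (1, X p) = dir_t R + (X p 0 i1 *: dir_x R i1 + X p 0 i2 *: dir_x R i2) :> V.
  rewrite /dir_t /dir_x /GRing.scale /= /GRing.add /=; congr pair.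
    by rewrite [X in _ + (X + _)]mulr0 [X in _ + (_ + X)]mulr0 !addr0.
  rewrite add0r; apply/rowP => j; rewrite !mxE eqxx /=.
  case: j => -[|[|//]] lt2; rewrite (bool_irrelevance lt2 isT) /=; ring.
rewrite !linearD !linearZ /= -!deriveE //.
have Cp := cyl0 Up.
have -> : 'D_(dir_t R) h (0, p) = pderiv a b (lie_fun X S k) p.
  transitivity (dirs (dir_x R i1) (dir_x R i2) a b (dir (dir_t R) (T k)) (0, p)).
    by apply: (derive_dirs open_O) => //; [exact: smooth_T|rewrite inE].
  rewrite dirs_slice; apply: pderiv_near => // q; rewrite inE; exact: derive_T.
have E j : 'D_(dir_x R j) h (0, p) =
    pderiv (a + (j == i1)) (b + (j == i2)) (fun q => S q 0 k) p.
  rewrite -pderiv_partial; last exact: smooth_coord.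
  rewrite -partial_pderiv; last exact: smooth_coord.
  rewrite -/(dir _ _ _) dir_slice; apply: near_partial => // q; rewrite inE => Uq.
  rewrite /h dirs_slice; apply: pderiv_near => // q1; rewrite inE; exact: T_slice.
by rewrite !E sum2E.
Qed.
End Flow.

(** * Jets *)

Section Jets.
Variable R : realType.

Lemma jcoefE n k (xi : jet R n k) i (m : midx k) :
  jcoef xi i (val m).1 (val m).2 = xi (i, m).
Proof. by rewrite /jcoef (big_pred1 m). Qed.

Lemma midx_exists k a b : (a + b <= k)%N ->
  exists m : midx k, (val m).1 = a :> nat /\ (val m).2 = b :> nat.
Proof.
move=> abk; have ak : (a < k.+1)%N by rewrite ltnS (leq_trans (leq_addr b a)).
have bk : (b < k.+1)%N by rewrite ltnS (leq_trans (leq_addl a b)).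
by exists (exist _ (Ordinal ak, Ordinal bk) abk).
Qed.

Lemma jcoef_mkjet n k F (i : 'I_n) a b : (a + b <= k)%N ->
  jcoef (mkjet k F : jet R n k) i a b = F i a b.
Proof. by move=> /midx_exists [m [<- <-]]; rewrite jcoefE ffunE. Qed.

Lemma jcoef_rho n k l (xi : jet R n k) (i : 'I_n) a b : (a + b <= l)%N ->
  jcoef (rho l xi) i a b = jcoef xi i a b.
Proof. exact: jcoef_mkjet. Qed.

Lemma jcoef_jet_of n k (F : plane R -> 'rV[R]_n) p i a b : (a + b <= k)%N ->
  jcoef (jet_of k F p) i a b = taylor F p i a b.
Proof. exact: jcoef_mkjet. Qed.

Lemma jet_eqP n k (xi eta : jet R n k) :
  (forall i a b, (a + b <= k)%N -> jcoef xi i a b = jcoef eta i a b) -> xi = eta.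
Proof.
by move=> E; apply/ffunP => -[i m]; rewrite -!jcoefE; apply: E; exact: (valP m).
Qed.

Lemma jcoefD n k (xi eta : jet R n k) i a b :
  jcoef (xi + eta) i a b = jcoef xi i a b + jcoef eta i a b.
Proof. by rewrite /jcoef -big_split; apply: eq_bigr => m _; rewrite ffunE. Qed.

Lemma jcoefN n k (xi : jet R n k) i a b : jcoef (- xi) i a b = - jcoef xi i a b.
Proof. by rewrite /jcoef -sumrN; apply: eq_bigr => m _; rewrite ffunE. Qed.

Lemma jcoefZ n k c (xi : jet R n k) i a b :
  jcoef (c *: xi) i a b = c * jcoef xi i a b.
Proof. by rewrite /jcoef mulr_sumr; apply: eq_bigr => m _; rewrite ffunE. Qed.

Lemma jcoef0 n k (i : 'I_n) a b : jcoef (0 : jet R n k) i a b = 0.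
Proof. by rewrite /jcoef big1 // => m _; rewrite ffunE. Qed.

End Jets.

Section Leibniz.
Variable R : realType.
Implicit Types F G : nat -> nat -> R.

Lemma shift1 F a b : shift i1 F a b = F a.+1 b.
Proof. by rewrite /shift /= addn1 addn0. Qed.

Lemma shift2 F a b : shift i2 F a b = F a b.+1.
Proof. by rewrite /shift /= addn1 addn0. Qed.

Lemma leibniz00 F G : leibniz F G 0 0 = F 0 0 * G 0 0.
Proof. by rewrite /leibniz !big_ord1 mul1r. Qed.

Lemma leibniz10 F G : leibniz F G 1 0 = F 0 0 * G 1 0 + F 1 0 * G 0 0.
Proof. by rewrite /leibniz big_ord_recl !big_ord1 !mul1r. Qed.

Lemma leibniz01 F G : leibniz F G 0 1 = F 0 0 * G 0 1 + F 0 1 * G 0 0.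
Proof. by rewrite /leibniz big_ord1 big_ord_recl !big_ord1 !mul1r. Qed.

Lemma leibniz20 F G :
  leibniz F G 2 0 = F 0 0 * G 2 0 + 2 * (F 1 0 * G 1 0) + F 2 0 * G 0 0.
Proof. by rewrite /leibniz !big_ord_recl !big_ord0 !addr0 !mul1r !addrA. Qed.

Lemma leibniz11 F G : leibniz F G 1 1 =
  F 0 0 * G 1 1 + F 0 1 * G 1 0 + F 1 0 * G 0 1 + F 1 1 * G 0 0.
Proof. by rewrite /leibniz !big_ord_recl !big_ord0 !addr0 !mul1r !addrA. Qed.

Lemma leibniz02 F G :
  leibniz F G 0 2 = F 0 0 * G 0 2 + 2 * (F 0 1 * G 0 1) + F 0 2 * G 0 0.
Proof. by rewrite /leibniz !big_ord_recl !big_ord0 !addr0 !mul1r !addrA. Qed.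

Lemma lie_coefE (X Y : 'I_2 -> nat -> nat -> R) i a b : lie_coef X Y i a b =
  leibniz (X i1) (shift i1 (Y i)) a b + leibniz (X i2) (shift i2 (Y i)) a b
  - leibniz (Y i1) (shift i1 (X i)) a b - leibniz (Y i2) (shift i2 (X i)) a b.
Proof.
have E j : \sum_(c < a.+1) \sum_(d < b.+1) ('C(a, c) * 'C(b, d))%N%:R *
    (X j c d * Y i (a - c + (j == i1))%N (b - d + (j == i2))%N
     - Y j c d * X i (a - c + (j == i1))%N (b - d + (j == i2))%N) =
    leibniz (X j) (shift j (Y i)) a b - leibniz (Y j) (shift j (X i)) a b.
  rewrite /leibniz -sumrB; apply: eq_bigr => c _; rewrite -sumrB.
  by apply: eq_bigr => d _; rewrite mulrBr.
by rewrite /lie_coef sum2E !E; ring.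
Qed.

Lemma order2_cases (P : nat -> nat -> Prop) :
  P 0 0 -> P 1 0 -> P 0 1 -> P 2 0 -> P 1 1 -> P 0 2 ->
  forall a b, (a + b <= 2)%N -> P a b.
Proof.
by move=> ? ? ? ? ? ? [|[|[|a]]] [|[|[|b]]] //; rewrite ?addnS ?addSn.
Qed.

End Leibniz.
Definition leibnizE := (leibniz00, leibniz10, leibniz01, leibniz20, leibniz11, leibniz02).
Definition shiftE := (shift1, shift2).

(** * From tangency of the lift to equations on jets *)

Section Aspace.
Variable R : realType.

(** The section used to compute the lift is fixed by theta_2 only to order 2, while [lie_jet] at
    order 2 contains third derivatives of it. They occur only in the top terms - X^j u_{sigma + j}
    of the transport, which the added sum cancels; hence such a section may be replaced by the
    coefficients of theta_3. *)
Lemma lie_jet_agree (X X' : 'I_2 -> nat -> nat -> R) (u u' : 'I_4 -> nat -> nat -> R) k :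
  (forall i a b, (a + b <= 4)%N -> X i a b = X' i a b) ->
  (forall i a b, (a + b <= 2)%N -> u i a b = u' i a b) ->
  forall a b, (a + b <= 2)%N ->
  lie_jet X u k a b +
    (X i1 0 0 * shift i1 (u k) a b + X i2 0 0 * shift i2 (u k) a b) =
  lie_jet X' u' k a b +
    (X' i1 0 0 * shift i1 (u' k) a b + X' i2 0 0 * shift i2 (u' k) a b).
Proof.
move=> XX' uu'.
have X00 i := XX' i 0 0 isT; have X10 i := XX' i 1 0 isT.
have X01 i := XX' i 0 1 isT; have X20 i := XX' i 2 0 isT.
have X11 i := XX' i 1 1 isT; have X02 i := XX' i 0 2 isT.
have X30 i := XX' i 3 0 isT; have X21 i := XX' i 2 1 isT.
have X12 i := XX' i 1 2 isT; have X03 i := XX' i 0 3 isT.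
have X40 i := XX' i 4 0 isT; have X31 i := XX' i 3 1 isT.
have X22 i := XX' i 2 2 isT; have X13 i := XX' i 1 3 isT.
have X04 i := XX' i 0 4 isT.
have u00 i := uu' i 0 0 isT; have u10 i := uu' i 1 0 isT.
have u01 i := uu' i 0 1 isT; have u20 i := uu' i 2 0 isT.
have u11 i := uu' i 1 1 isT; have u02 i := uu' i 0 2 isT.
case: k => -[|[|[|[|//]]]] lt4; rewrite (bool_irrelevance lt4 isT) /lie_jet /lie_terms;
  apply: order2_cases; rewrite /= !big_cons !big_nil /= ?leibnizE !shiftE;
  rewrite !(X00, X10, X01, X20, X11, X02, X30, X21, X12, X03, X40, X31, X22, X13, X04);
  rewrite !(u00, u10, u01, u20, u11, u02); ring.
Qed.

Lemma derive_sum_partial (h : plane R -> R) v q : differentiable h q ->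
  'D_v h q = v 0 i1 * partial i1 h q + v 0 i2 * partial i2 h q.
Proof.
move=> dh; rewrite deriveE // [in LHS](row_sum_delta v) linear_sum.
by rewrite sum2E !linearZ /partial -!deriveE.
Qed.

(* The lift of [X] at [theta] is tangent to the graph of [j_2 S] exactly when
   the 2-jet of the Lie derivative of [S] along [X] vanishes; [lie_jet] is that
   jet in coordinates. *)
Lemma Aspace_lie_jet (theta : Jpi R 3) (xi : jet R 2 4) : Aspace theta xi ->
  forall k a b, (a + b <= 2)%N ->
  lie_jet (jcoef xi) (jcoef theta.2) k a b = 0.
Proof.
move=> [X [V [XT xiE [S [f [ST SE [U [e [[oU Up e0] fU f0 fd fa]]] V1 V2]]]
  [S' [v [S'T S'E VE]]]]]] k a b ab2.
set p := theta.1 in xiE SE Up V1 V2 S'E VE.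
have fp : is_derive (0 : R^o) (1 : R^o) (fun s : R^o => f s p) (X p).
  by have := fd 0 p; rewrite normr0 f0 //; apply.
have vE : v = X p.
  have -> : v = V.1 by rewrite VE.
  by case: V1 => _ <-; case: fp => _ <-.
have [m [ma mb]] := midx_exists ab2.
have := flow_derive XT ST oU e0 fU f0 fd fa k a b Up.
move=> [_ dE]; have := V2 (k, m); rewrite VE /= !ffunE.
move=> [_ V2E].
have {V2E} : pderiv a b (lie_fun X S k) p +
    \sum_j X p 0 j * pderiv (a + (j == i1)) (b + (j == i2)) (fun q => S q 0 k) p =
  'D_v (fun q => jet_of 2 S' q (k, m)) p.
  apply: etrans (esym dE) (etrans _ V2E).
  apply: (f_equal (fun h : R^o -> R^o => 'D_1 h 0)); apply: funext => t.
  by rewrite /lift_jet /= ffunE /= ma mb.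
have -> : (fun q => jet_of 2 S' q (k, m)) = pderiv a b (fun q => S' q 0 k).
  by apply: funext => q; rewrite ffunE /= ma mb.
have Sk := smooth_coord k ST; have Sk' := smooth_coord k S'T.
rewrite derive_sum_partial; last first.
  exact: (smooth_on_differentiable (smooth_pderiv a b Sk')).
rewrite !partial_pderiv // !pderiv_partial // vE pderiv_lie_fun //.
rewrite sum2E.
have X0 i : X p 0 i = taylor X p i 0 0 by [].
have Xxi i c d : (c + d <= 4)%N -> taylor X p i c d = jcoef xi i c d.
  by move=> cd; rewrite -xiE jcoef_jet_of.
have Su i c d : (c + d <= 2)%N -> taylor S p i c d = jcoef theta.2 i c d.
  move=> cd; rewrite -(@jcoef_rho _ _ _ 2) // -[rho 2 _]/((pi_ 2 theta).2) -SE.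
  by rewrite jcoef_jet_of.
rewrite !X0; have := lie_jet_agree k Xxi Su ab2.
rewrite /shift {1}/taylor => ->.
(* The second section [S'] realizes all of theta_3, so the derivative of its 2-jet along X(p) is
   exactly the transport sum added in [lie_jet_agree]; subtracting it leaves [lie_jet] alone. *)
have S3 c d : (c + d <= 3)%N ->
    pderiv c d (fun q => S' q 0 k) p = jcoef theta.2 k c d.
  by move=> cd; rewrite -S'E jcoef_jet_of.
rewrite !Xxi // !S3; first by move=> /eqP; rewrite -subr_eq0 addrK => /eqP.
all: by move: ab2; rewrite /= ?addn1 ?addn0 ?addnS ?addSn.
Qed.
End Aspace.

(** * The Liouville tensor and brackets of infinitesimal symmetries *)

Section FormalLiouville.
Variable R : realType.
Implicit Types (X Y : 'I_2 -> nat -> nat -> R) (u : 'I_4 -> nat -> nat -> R).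

Local Notation j0 := (@Ordinal 4 0 isT).
Local Notation j1 := (@Ordinal 4 1 isT).
Local Notation j2 := (@Ordinal 4 2 isT).
Local Notation j3 := (@Ordinal 4 3 isT).

Definition F1_jet u a b : R :=
  3 * shift i2 (shift i2 (u j0)) a b - 2 * shift i1 (shift i2 (u j1)) a b
  + shift i1 (shift i1 (u j2)) a b
  + 3 * leibniz (u j3) (shift i1 (u j0)) a b - 3 * leibniz (u j2) (shift i2 (u j0)) a b
  + 2 * leibniz (u j1) (shift i2 (u j1)) a b - leibniz (u j1) (shift i1 (u j2)) a b
  - 3 * leibniz (u j0) (shift i2 (u j2)) a b + 6 * leibniz (u j0) (shift i1 (u j3)) a b.

Definition F2_jet u a b : R :=
  shift i2 (shift i2 (u j1)) a b - 2 * shift i1 (shift i2 (u j2)) a b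
  + 3 * shift i1 (shift i1 (u j3)) a b
  - 3 * leibniz (u j0) (shift i2 (u j3)) a b + 3 * leibniz (u j1) (shift i1 (u j3)) a b
  - 2 * leibniz (u j2) (shift i1 (u j2)) a b + leibniz (u j2) (shift i2 (u j1)) a b
  + 3 * leibniz (u j3) (shift i1 (u j1)) a b - 6 * leibniz (u j3) (shift i2 (u j0)) a b.

Lemma F1_jetE (theta : Jpi R 3) : F1 (pi_ 2 theta) = F1_jet (jcoef theta.2) 0 0.
Proof. by rewrite /F1 /F1_jet /= !jcoef_rho // !leibnizE !shiftE; ring. Qed.

Lemma F2_jetE (theta : Jpi R 3) : F2 (pi_ 2 theta) = F2_jet (jcoef theta.2) 0 0.
Proof. by rewrite /F2 /F2_jet /= !jcoef_rho // !leibnizE !shiftE; ring. Qed.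

Lemma lie_jet0E X u a b : lie_jet X u j0 a b =
  shift i1 (shift i1 (X i2)) a b + leibniz (shift i2 (X i2)) (u j0) a b
  - 2 * leibniz (shift i1 (X i1)) (u j0) a b - leibniz (shift i1 (X i2)) (u j1) a b
  - leibniz (X i1) (shift i1 (u j0)) a b - leibniz (X i2) (shift i2 (u j0)) a b.
Proof. by rewrite /lie_jet /lie_terms /= !big_cons big_nil /=; ring. Qed.

Lemma lie_jet1E X u a b : lie_jet X u j1 a b =
  2 * shift i1 (shift i2 (X i2)) a b - shift i1 (shift i1 (X i1)) a b
  - leibniz (shift i1 (X i1)) (u j1) a b - 2 * leibniz (shift i1 (X i2)) (u j2) a b
  - 3 * leibniz (shift i2 (X i1)) (u j0) a b
  - leibniz (X i1) (shift i1 (u j1)) a b - leibniz (X i2) (shift i2 (u j1)) a b.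
Proof. by rewrite /lie_jet /lie_terms /= !big_cons big_nil /=; ring. Qed.

Lemma lie_jet2E X u a b : lie_jet X u j2 a b =
  shift i2 (shift i2 (X i2)) a b - 2 * shift i1 (shift i2 (X i1)) a b
  - leibniz (shift i2 (X i2)) (u j2) a b - 3 * leibniz (shift i1 (X i2)) (u j3) a b
  - 2 * leibniz (shift i2 (X i1)) (u j1) a b
  - leibniz (X i1) (shift i1 (u j2)) a b - leibniz (X i2) (shift i2 (u j2)) a b.
Proof. by rewrite /lie_jet /lie_terms /= !big_cons big_nil /=; ring. Qed.

Lemma lie_jet3E X u a b : lie_jet X u j3 a b =
  - shift i2 (shift i2 (X i1)) a b + leibniz (shift i1 (X i1)) (u j3) a b
  - 2 * leibniz (shift i2 (X i2)) (u j3) a b - leibniz (shift i2 (X i1)) (u j2) a b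
  - leibniz (X i1) (shift i1 (u j3)) a b - leibniz (X i2) (shift i2 (u j3)) a b.
Proof. by rewrite /lie_jet /lie_terms /= !big_cons big_nil /=; ring. Qed.

Definition lie_jetE := (lie_jet0E, lie_jet1E, lie_jet2E, lie_jet3E).

(* [F^k dx^k (x) (dx^1 /\ dx^2)] is an invariant of sections, so the linearization
   of [F] at [u] sends the jet of the Lie derivative of [u] along [X] to the Lie
   derivative of this tensor. *)
Lemma lie_F1 X u :
  (forall k a b, (a + b <= 2)%N -> lie_jet X u k a b = 0) ->
  X i1 0 0 * F1_jet u 1 0 + X i2 0 0 * F1_jet u 0 1
  + X i1 1 0 * F1_jet u 0 0 + X i2 1 0 * F2_jet u 0 0
  + (X i1 1 0 + X i2 0 1) * F1_jet u 0 0 = 0.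
Proof.
move=> E; transitivity (-
  (3 * lie_jet X u j0 0 2 - 2 * lie_jet X u j1 1 1 + lie_jet X u j2 2 0
   + 3 * (lie_jet X u j3 0 0 * u j0 1 0 + u j3 0 0 * lie_jet X u j0 1 0)
   - 3 * (lie_jet X u j2 0 0 * u j0 0 1 + u j2 0 0 * lie_jet X u j0 0 1)
   + 2 * (lie_jet X u j1 0 0 * u j1 0 1 + u j1 0 0 * lie_jet X u j1 0 1)
   - (lie_jet X u j1 0 0 * u j2 1 0 + u j1 0 0 * lie_jet X u j2 1 0)
   - 3 * (lie_jet X u j0 0 0 * u j2 0 1 + u j0 0 0 * lie_jet X u j2 0 1)
   + 6 * (lie_jet X u j0 0 0 * u j3 1 0 + u j0 0 0 * lie_jet X u j3 1 0))); last first.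
  by rewrite !E //; ring.
by rewrite !lie_jetE /F1_jet /F2_jet !leibnizE !shiftE; ring.
Qed.

Lemma lie_F2 X u :
  (forall k a b, (a + b <= 2)%N -> lie_jet X u k a b = 0) ->
  X i1 0 0 * F2_jet u 1 0 + X i2 0 0 * F2_jet u 0 1
  + X i1 0 1 * F1_jet u 0 0 + X i2 0 1 * F2_jet u 0 0
  + (X i1 1 0 + X i2 0 1) * F2_jet u 0 0 = 0.
Proof.
move=> E; transitivity (-
  (lie_jet X u j1 0 2 - 2 * lie_jet X u j2 1 1 + 3 * lie_jet X u j3 2 0
   - 3 * (lie_jet X u j0 0 0 * u j3 0 1 + u j0 0 0 * lie_jet X u j3 0 1)
   + 3 * (lie_jet X u j1 0 0 * u j3 1 0 + u j1 0 0 * lie_jet X u j3 1 0)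
   - 2 * (lie_jet X u j2 0 0 * u j2 1 0 + u j2 0 0 * lie_jet X u j2 1 0)
   + (lie_jet X u j2 0 0 * u j1 0 1 + u j2 0 0 * lie_jet X u j1 0 1)
   + 3 * (lie_jet X u j3 0 0 * u j1 1 0 + u j3 0 0 * lie_jet X u j1 1 0)
   - 6 * (lie_jet X u j3 0 0 * u j0 0 1 + u j3 0 0 * lie_jet X u j0 0 1))); last first.
  by rewrite !E //; ring.
by rewrite !lie_jetE /F1_jet /F2_jet !leibnizE !shiftE; ring.
Qed.

End FormalLiouville.

Section BracketInvariance.
Variable R : realType.
Implicit Types (F G : nat -> nat -> R).
Implicit Types (X Y : 'I_2 -> nat -> nat -> R) (u : 'I_4 -> nat -> nat -> R).

Local Notation j0 := (@Ordinal 4 0 isT).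
Local Notation j1 := (@Ordinal 4 1 isT).
Local Notation j2 := (@Ordinal 4 2 isT).
Local Notation j3 := (@Ordinal 4 3 isT).

(** The transport terms differentiate [e] once more, so order 1 of the result reads [e] up to order
    2. This is the order lost in passing to brackets. *)
Lemma lie_jet_linear0 X (e : 'I_4 -> nat -> nat -> R) :
  (forall k a b, (a + b <= 2)%N -> e k a b = 0) ->
  forall k a b, (a + b <= 1)%N -> lie_jet X e k a b = lie_jet X (fun _ _ _ => 0) k a b.
Proof.
move=> E [[|[|[|[|//]]]] lt4] a b; rewrite (bool_irrelevance lt4 isT);
  case: a => [|[|//]]; case: b => [|[|//]] // _;
  by rewrite !lie_jetE !leibnizE !shiftE !E.
Qed.

(* A product that computes on literals: rewriting the sums in [leibniz] one by
   one in the large identity below would be too slow. *)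
Definition leib F G (a b : nat) : R :=
  match a, b with
  | 0, 0 => F 0 0 * G 0 0
  | 1, 0 => F 0 0 * G 1 0 + F 1 0 * G 0 0
  | 0, 1 => F 0 0 * G 0 1 + F 0 1 * G 0 0
  | 2, 0 => F 0 0 * G 2 0 + 2 * (F 1 0 * G 1 0) + F 2 0 * G 0 0
  | 1, 1 => F 0 0 * G 1 1 + F 0 1 * G 1 0 + F 1 0 * G 0 1 + F 1 1 * G 0 0
  | 0, 2 => F 0 0 * G 0 2 + 2 * (F 0 1 * G 0 1) + F 0 2 * G 0 0
  | 3, 0 => F 0 0 * G 3 0 + 3 * (F 1 0 * G 2 0) + 3 * (F 2 0 * G 1 0) + F 3 0 * G 0 0
  | 2, 1 => F 0 0 * G 2 1 + F 0 1 * G 2 0 + 2 * (F 1 0 * G 1 1)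
            + 2 * (F 1 1 * G 1 0) + F 2 0 * G 0 1 + F 2 1 * G 0 0
  | 1, 2 => F 0 0 * G 1 2 + 2 * (F 0 1 * G 1 1) + F 0 2 * G 1 0
            + F 1 0 * G 0 2 + 2 * (F 1 1 * G 0 1) + F 1 2 * G 0 0
  | 0, 3 => F 0 0 * G 0 3 + 3 * (F 0 1 * G 0 2) + 3 * (F 0 2 * G 0 1) + F 0 3 * G 0 0
  | _, _ => leibniz F G a b
  end.

Lemma leibE F G a b : leibniz F G a b = leib F G a b.
Proof.
by case: a => [|[|[|[|a]]]]; case: b => [|[|[|[|b]]]] //=; rewrite ?leibnizE //;
  rewrite /leibniz !big_ord_recl !big_ord0 !addr0 !mul1r !addrA.
Qed.

Let d1 F a b := F a.+1 b.
Let d2 F a b := F a b.+1.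

Definition lie_jet_comp X u (k : 'I_4) (a b : nat) : R :=
  match val k with
  | 0 => d1 (d1 (X i2)) a b + leib (d2 (X i2)) (u j0) a b
    - 2 * leib (d1 (X i1)) (u j0) a b - leib (d1 (X i2)) (u j1) a b
    - leib (X i1) (d1 (u j0)) a b - leib (X i2) (d2 (u j0)) a b
  | 1 => 2 * d1 (d2 (X i2)) a b - d1 (d1 (X i1)) a b
    - leib (d1 (X i1)) (u j1) a b - 2 * leib (d1 (X i2)) (u j2) a b
    - 3 * leib (d2 (X i1)) (u j0) a b
    - leib (X i1) (d1 (u j1)) a b - leib (X i2) (d2 (u j1)) a b
  | 2 => d2 (d2 (X i2)) a b - 2 * d1 (d2 (X i1)) a b
    - leib (d2 (X i2)) (u j2) a b - 3 * leib (d1 (X i2)) (u j3) a b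
    - 2 * leib (d2 (X i1)) (u j1) a b
    - leib (X i1) (d1 (u j2)) a b - leib (X i2) (d2 (u j2)) a b
  | _ => - d2 (d2 (X i1)) a b + leib (d1 (X i1)) (u j3) a b
    - 2 * leib (d2 (X i2)) (u j3) a b - leib (d2 (X i1)) (u j2) a b
    - leib (X i1) (d1 (u j3)) a b - leib (X i2) (d2 (u j3)) a b
  end.

Definition lie_coef_comp X Y (i : 'I_2) (a b : nat) : R :=
  leib (X i1) (d1 (Y i)) a b + leib (X i2) (d2 (Y i)) a b
  - leib (Y i1) (d1 (X i)) a b - leib (Y i2) (d2 (X i)) a b.

Let shift1_fun F : shift i1 F = d1 F.
Proof. by apply: funext => a; apply: funext => b; rewrite shift1. Qed.

Let shift2_fun F : shift i2 F = d2 F.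
Proof. by apply: funext => a; apply: funext => b; rewrite shift2. Qed.

Lemma lie_jet_compE X u : lie_jet X u = lie_jet_comp X u.
Proof.
apply: funext => -[[|[|[|[|//]]]] lt4]; rewrite (bool_irrelevance lt4 isT);
  apply: funext => a; apply: funext => b;
  by rewrite lie_jetE !shift1_fun !shift2_fun !leibE.
Qed.

Lemma lie_coef_compE X Y : lie_coef X Y = lie_coef_comp X Y.
Proof.
apply: funext => i; apply: funext => a; apply: funext => b.
by rewrite lie_coefE !shift1_fun !shift2_fun !leibE.
Qed.

(* [L_[X,Y] S = L_X L_Y S - L_Y L_X S]; the fibres being affine, the outer Lie
   derivatives act by the linear part [lie_jet X e - lie_jet X 0]. *)
Lemma lie_jet_bracket X Y u k a b : (a + b <= 1)%N ->
  lie_jet (lie_coef X Y) u k a b =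
  (lie_jet Y (lie_jet X u) k a b - lie_jet Y (fun _ _ _ => 0) k a b)
  - (lie_jet X (lie_jet Y u) k a b - lie_jet X (fun _ _ _ => 0) k a b).
Proof.
(* [lie_jet] is minus the Lie derivative, being the velocity of the pushed-forward section; hence
   [X] and [Y] appear exchanged with respect to the commutator formula. *)
rewrite !lie_jet_compE lie_coef_compE.
case: k => -[|[|[|[|//]]]] lt4; case: a => [|[|//]]; case: b => [|[|//]] // _;
  rewrite /lie_jet_comp /lie_coef_comp /d1 /d2 /=; ring.
Qed.

Lemma lie_jet_bracket0 X Y u :
  (forall k a b, (a + b <= 2)%N -> lie_jet X u k a b = 0) ->
  (forall k a b, (a + b <= 2)%N -> lie_jet Y u k a b = 0) ->
  forall k a b, (a + b <= 1)%N -> lie_jet (lie_coef X Y) u k a b = 0.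
Proof.
move=> EX EY k a b ab1; rewrite lie_jet_bracket //.
by rewrite (lie_jet_linear0 Y EX) // (lie_jet_linear0 X EY) // !subrr.
Qed.

End BracketInvariance.

(** * The bracket of the lifts of the two coordinate vectors *)

Section HorizontalPair.
Variable R : realType.
Variables (X Y : 'I_2 -> nat -> nat -> R) (u : 'I_4 -> nat -> nat -> R).

Local Notation j0 := (@Ordinal 4 0 isT).
Local Notation j1 := (@Ordinal 4 1 isT).
Local Notation j2 := (@Ordinal 4 2 isT).
Local Notation j3 := (@Ordinal 4 3 isT).

Hypothesis EX : forall k a b, (a + b <= 2)%N -> lie_jet X u k a b = 0.
Hypothesis EY : forall k a b, (a + b <= 2)%N -> lie_jet Y u k a b = 0.
Hypotheses (X1 : X i1 0 0 = 1) (X2 : X i2 0 0 = 0).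
Hypotheses (Y1 : Y i1 0 0 = 0) (Y2 : Y i2 0 0 = 1).
Hypothesis star : forall i a b, (a + b <= 1)%N -> lie_coef X Y i a b = 0.

Local Notation C := (lie_coef X Y).

(** The sign fits the coefficient - 1 of the transport terms: for a lift of d_1 the vanishing
    quantity [e] is b - u_x, solved for [a] = u_x. *)
Let eq_of_vanishing (a b e : R) : e = 0 -> a - b = - e -> a = b.
Proof. by move=> ->; rewrite oppr0 => /subr0_eq. Qed.

Local Ltac isolate H := apply: (eq_of_vanishing H);
  rewrite ?lie_jetE ?lie_coefE !leibnizE ?shiftE ?X1 ?X2 ?Y1 ?Y2; ring.

Lemma pair_sym i : Y i 1 0 = X i 0 1.
Proof. by apply/esym; isolate (star i (a := 0) (b := 0) isT). Qed.

Lemma pair20 i : Y i 2 0 = X i 1 1 - X i1 1 0 * Y i 1 0 - X i2 1 0 * Y i 0 1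
  + Y i1 1 0 * X i 1 0 + Y i2 1 0 * X i 0 1.
Proof.
apply/esym; isolate (star i (a := 1) (b := 0) isT).
Qed.

Lemma pair11 i : Y i 1 1 = X i 0 2 - X i1 0 1 * Y i 1 0 - X i2 0 1 * Y i 0 1
  + Y i1 0 1 * X i 1 0 + Y i2 0 1 * X i 0 1.
Proof. by apply/esym; isolate (star i (a := 0) (b := 1) isT). Qed.

Let EC k a b : (a + b <= 1)%N -> lie_jet C u k a b = 0.
Proof. exact: lie_jet_bracket0. Qed.

Let C00 i : C i 0 0 = 0 := star i (a := 0) (b := 0) isT.
Let C10 i : C i 1 0 = 0 := star i (a := 1) (b := 0) isT.
Let C01 i : C i 0 1 = 0 := star i (a := 0) (b := 1) isT.

(** As the 1-jet of the bracket is zero, its order 0 equations keep only the [Second] terms of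
    [lie_terms], and their vanishing is the system defining g^2. *)
Lemma bracket_g2 : [/\ C i2 2 0 = 0, C i1 2 0 = 2 * C i2 1 1,
  C i2 0 2 = 2 * C i1 1 1 & C i1 0 2 = 0].
Proof.
have := (EC j0 (a := 0) (b := 0) isT, EC j1 (a := 0) (b := 0) isT,
  EC j2 (a := 0) (b := 0) isT, EC j3 (a := 0) (b := 0) isT).
rewrite !lie_jetE !leibnizE !shiftE !C00 !C10 !C01 !(mul0r, mulr0, subr0, addr0).
move=> [[[-> /eqP]]]; rewrite subr_eq0 => /eqP <- /eqP.
by rewrite subr_eq0 => /eqP -> /eqP; rewrite oppr_eq0 => /eqP ->.
Qed.

(* The equations of order 0 and 1 give [u_x] and [u_xx] in terms of the jets of
   [X] and [Y]; substituting them into [F] and using (star) leaves the bracket. *)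
Lemma bracket_Liouville :
  C i2 1 1 = 3^-1 * F1_jet u 0 0 /\ C i1 1 1 = 3^-1 * F2_jet u 0 0.
Proof.
have u0_10 : u j0 1 0 = X i2 2 0 + X i2 0 1 * u j0 0 0 - 2 * X i1 1 0 * u j0 0 0
    - X i2 1 0 * u j1 0 0 by isolate (EX j0 (a := 0) (b := 0) isT).
have u1_10 : u j1 1 0 = 2 * X i2 1 1 - X i1 2 0 - X i1 1 0 * u j1 0 0
    - 2 * X i2 1 0 * u j2 0 0 - 3 * X i1 0 1 * u j0 0 0.
  by isolate (EX j1 (a := 0) (b := 0) isT).
have u2_10 : u j2 1 0 = X i2 0 2 - 2 * X i1 1 1 - X i2 0 1 * u j2 0 0
    - 3 * X i2 1 0 * u j3 0 0 - 2 * X i1 0 1 * u j1 0 0.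
  by isolate (EX j2 (a := 0) (b := 0) isT).
have u3_10 : u j3 1 0 = - X i1 0 2 + X i1 1 0 * u j3 0 0 - 2 * X i2 0 1 * u j3 0 0
    - X i1 0 1 * u j2 0 0 by isolate (EX j3 (a := 0) (b := 0) isT).
have u0_01 : u j0 0 1 = Y i2 2 0 + Y i2 0 1 * u j0 0 0 - 2 * Y i1 1 0 * u j0 0 0
    - Y i2 1 0 * u j1 0 0 by isolate (EY j0 (a := 0) (b := 0) isT).
have u1_01 : u j1 0 1 = 2 * Y i2 1 1 - Y i1 2 0 - Y i1 1 0 * u j1 0 0
    - 2 * Y i2 1 0 * u j2 0 0 - 3 * Y i1 0 1 * u j0 0 0.
  by isolate (EY j1 (a := 0) (b := 0) isT).
have u2_01 : u j2 0 1 = Y i2 0 2 - 2 * Y i1 1 1 - Y i2 0 1 * u j2 0 0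
    - 3 * Y i2 1 0 * u j3 0 0 - 2 * Y i1 0 1 * u j1 0 0.
  by isolate (EY j2 (a := 0) (b := 0) isT).
have u3_01 : u j3 0 1 = - Y i1 0 2 + Y i1 1 0 * u j3 0 0 - 2 * Y i2 0 1 * u j3 0 0
    - Y i1 0 1 * u j2 0 0 by isolate (EY j3 (a := 0) (b := 0) isT).
(* Each second derivative is solved from the equation of [X] or of [Y] so that third derivatives of
   the lifts enter F only as in the bracket: 3 (Y^2_112 - X^2_122) in F^1, and 2 (Y^2_122 - X^2_222)
   - (Y^1_112 - X^1_122) in F^2. *)
have u0_02 : u j0 0 2 = Y i2 2 1 + leibniz (shift i2 (Y i2)) (u j0) 0 1
    - 2 * leibniz (shift i1 (Y i1)) (u j0) 0 1 - leibniz (shift i1 (Y i2)) (u j1) 0 1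
    - Y i1 0 1 * u j0 1 0 - Y i2 0 1 * u j0 0 1.
  by isolate (EY j0 (a := 0) (b := 1) isT).
have u1_11 : u j1 1 1 = 2 * X i2 1 2 - X i1 2 1 - leibniz (shift i1 (X i1)) (u j1) 0 1
    - 2 * leibniz (shift i1 (X i2)) (u j2) 0 1 - 3 * leibniz (shift i2 (X i1)) (u j0) 0 1
    - X i1 0 1 * u j1 1 0 - X i2 0 1 * u j1 0 1.
  by isolate (EX j1 (a := 0) (b := 1) isT).
have u2_20 : u j2 2 0 = X i2 1 2 - 2 * X i1 2 1 - leibniz (shift i2 (X i2)) (u j2) 1 0
    - 3 * leibniz (shift i1 (X i2)) (u j3) 1 0 - 2 * leibniz (shift i2 (X i1)) (u j1) 1 0
    - X i1 1 0 * u j2 1 0 - X i2 1 0 * u j2 0 1.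
  by isolate (EX j2 (a := 1) (b := 0) isT).
have u1_02 : u j1 0 2 = 2 * Y i2 1 2 - Y i1 2 1 - leibniz (shift i1 (Y i1)) (u j1) 0 1
    - 2 * leibniz (shift i1 (Y i2)) (u j2) 0 1 - 3 * leibniz (shift i2 (Y i1)) (u j0) 0 1
    - Y i1 0 1 * u j1 1 0 - Y i2 0 1 * u j1 0 1.
  by isolate (EY j1 (a := 0) (b := 1) isT).
have u2_11 : u j2 1 1 = X i2 0 3 - 2 * X i1 1 2 - leibniz (shift i2 (X i2)) (u j2) 0 1
    - 3 * leibniz (shift i1 (X i2)) (u j3) 0 1 - 2 * leibniz (shift i2 (X i1)) (u j1) 0 1
    - X i1 0 1 * u j2 1 0 - X i2 0 1 * u j2 0 1.
  by isolate (EX j2 (a := 0) (b := 1) isT).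
have u3_20 : u j3 2 0 = - X i1 1 2 + leibniz (shift i1 (X i1)) (u j3) 1 0
    - 2 * leibniz (shift i2 (X i2)) (u j3) 1 0 - leibniz (shift i2 (X i1)) (u j2) 1 0
    - X i1 1 0 * u j3 1 0 - X i2 1 0 * u j3 0 1.
  by isolate (EX j3 (a := 1) (b := 0) isT).
have subst := (u0_02, u1_11, u2_20, u1_02, u2_11, u3_20).
have subst1 := (u0_10, u1_10, u2_10, u3_10, u0_01, u1_01, u2_01, u3_01).
have E1 : 3 * C i2 1 1 = F1_jet u 0 0.
  rewrite /F1_jet lie_coefE !leibnizE !shiftE !subst !leibnizE !shiftE !subst1.
  by rewrite !pair20 !pair11 !pair_sym X1 X2 Y1 Y2; ring.
(* By the g^2 relation C^2_22 = 2 C^1_12 the left side is (4 - 1) C^1_12, whence the same factor 3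
   as for F^1. *)
have E2 : 2 * C i2 0 2 - C i1 1 1 = F2_jet u 0 0.
  rewrite /F2_jet !lie_coefE !leibnizE !shiftE !subst !leibnizE !shiftE !subst1.
  by rewrite !pair20 !pair11 !pair_sym X1 X2 Y1 Y2; ring.
have [_ _ C02 _] := bracket_g2; rewrite C02 in E2.
by split; [rewrite -E1 | rewrite -E2]; field.
Qed.

(** The order 1 equations are linear in the third-order coefficients of the bracket. The second and
    third components contain 2 C^2_12 - C^1_11 and C^2_22 - 2 C^1_12, differentiated once; suitable
    pairs of equations isolate the divergence C^r_rjk. Derivatives of the section drop out because
    the 1-jet of the bracket is zero. *)
Lemma bracket_trace :
  [/\ C i1 3 0 + C i2 2 1 = C i2 1 1 * u j1 0 0 - 3 * (C i1 1 1 * u j0 0 0),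
   C i1 2 1 + C i2 1 2 = C i2 1 1 * u j2 0 0 - C i1 1 1 * u j1 0 0 &
   C i1 1 2 + C i2 0 3 = 3 * (C i2 1 1 * u j3 0 0) - C i1 1 1 * u j2 0 0].
Proof.
have [C2_20 C1_20 C2_02 C1_02] := bracket_g2.
have e0 := EC j0 (a := 0) (b := 1) isT.
have e1 := EC j1 (a := 1) (b := 0) isT; have e1' := EC j1 (a := 0) (b := 1) isT.
have e2 := EC j2 (a := 1) (b := 0) isT; have e2' := EC j2 (a := 0) (b := 1) isT.
have e3 := EC j3 (a := 1) (b := 0) isT.
move: e0 e1 e1' e2 e2' e3; rewrite !lie_jetE !leibnizE !shiftE.
rewrite !C00 !C10 !C01 C2_20 C1_20 C2_02 C1_02.
move: (C i2 1 1) (C i1 1 1) (C i1 3 0) (C i2 2 1) (C i1 2 1) (C i2 1 2) (C i1 1 2)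
  (C i2 0 3) => c1 c2 c30 d21 c21 d12 c12 d03.
move: (u j0 0 0) (u j1 0 0) (u j2 0 0) (u j3 0 0) (u j0 1 0) (u j1 1 0) (u j2 1 0)
  (u j3 1 0) (u j0 0 1) (u j1 0 1) (u j2 0 1) (u j3 0 1) => u0 u1 u2 u3 *.
by split; lra.
Qed.

End HorizontalPair.

(** * The trace of t_H *)

Section TraceOfT.
Variable R : realType.
Implicit Types (h : 'I_2 -> 'I_2 -> nat -> nat -> R) (C : 'I_2 -> nat -> nat -> R).
Implicit Types (u : 'I_4 -> nat -> nat -> R).

Local Notation j0 := (@Ordinal 4 0 isT).
Local Notation j1 := (@Ordinal 4 1 isT).
Local Notation j2 := (@Ordinal 4 2 isT).
Local Notation j3 := (@Ordinal 4 3 isT).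

Lemma lie_coef_agree n (X X' Y Y' : 'I_2 -> nat -> nat -> R) i a b :
  (forall i a b, (a + b <= n.+1)%N -> X i a b = X' i a b) ->
  (forall i a b, (a + b <= n.+1)%N -> Y i a b = Y' i a b) ->
  (a + b <= n)%N -> lie_coef X Y i a b = lie_coef X' Y' i a b.
Proof.
move=> XX' YY' abn; apply: eq_bigr => j _; apply: eq_bigr => c _.
apply: eq_bigr => d _; have := ltn_ord c; have := ltn_ord d; rewrite !ltnS => db ca.
have cd : (c + d <= n.+1)%N by rewrite (leq_trans (leq_add ca db)) // leqW.
have cd' : (a - c + (j == i1) + (b - d + (j == i2)) <= n.+1)%N.
  have jj : ((j == i1) + (j == i2) <= 1)%N by case: j => -[|[|]].
  rewrite addnACA (leq_trans (leq_add (leq_add (leq_subr c a) (leq_subr d b)) jj)) //.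
  by rewrite addn1.
by rewrite !XX' // !YY'.
Qed.

(* [h m] is the jet of the lift of [d_{x^m}], and [C] that of the bracket of the
   two lifts; this is [t_H (d_1, d_2, d_l, d_r)^r_k] summed over [r]. *)
Definition trace_t h C (l k : 'I_2) : R :=
  \sum_r (lie_coef (h r) (lie_coef (h l) C) r (k == i1) (k == i2)
    - \sum_m lie_coef (h r) (lie_coef (h l) C) m 0 0 * h m r (k == i1) (k == i2)).

(** Here C^i_jk = delta^i_j c_k + delta^i_k c_j, so C^r_mr = 3 c_m in dimension two: this is the 3,
    and it arises from the second derivatives of w = [h_l, C]. The other terms G^m_lk c_m, one from
    [h_r, w] and one from the subtracted lift, cancel. The traces that remain are - C^m_lk g_m. *)
Lemma trace_tE h C :
  (forall m i, h m i 0 0 = (i == m)%:R) -> (forall i, h i2 i 1 0 = h i1 i 0 1) ->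
  (forall i, C i 0 0 = 0) -> (forall i, C i 1 0 = 0) -> (forall i, C i 0 1 = 0) ->
  C i2 2 0 = 0 -> C i1 2 0 = 2 * C i2 1 1 -> C i2 0 2 = 2 * C i1 1 1 ->
  C i1 0 2 = 0 ->
  forall l k, let c (k : 'I_2) := if k == i1 then C i2 1 1 else C i1 1 1 in
  trace_t h C l k =
    C i1 (1 + (l == i1) + (k == i1))%N ((l == i2) + (k == i2))%N +
    C i2 ((l == i1) + (k == i1))%N (1 + (l == i2) + (k == i2))%N +
    3 * (h l i1 (k == i1) (k == i2) * c i1 + h l i2 (k == i1) (k == i2) * c i2)
    - c k * (h l i1 1%N 0%N + h l i2 0%N 1%N) - c l * (h k i1 1%N 0%N + h k i2 0%N 1%N).
Proof.
move=> h0 hS C00 C10 C01 C2_20 C1_20 C2_02 C1_02 l k.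
have C_ := (C00, C10, C01, C2_20, C1_20, C2_02, C1_02).
rewrite /trace_t !sum2E.
case: l => -[|[|//]] ltl; rewrite (bool_irrelevance ltl isT);
  case: k => -[|[|//]] ltk; rewrite (bool_irrelevance ltk isT) /=;
  rewrite !lie_coef_compE /lie_coef_comp /= !C_ !h0 /= !hS; ring.
Qed.

(* Obtained from [beta^l trace_t_lk] by substituting [c = F / 3], for which
   [beta^l c_l = 0], and eliminating the 1-jets of [H] through the invariance of
   [F]: the trace [beta^l g_l] of the 1-jets is the curl of [F]. *)
Definition Omega u (k : 'I_2) : R :=
  let F1 := F1_jet u 0 0 in let F2 := F2_jet u 0 0 in
  let curl := F1_jet u 0 1 - F2_jet u 1 0 in
  if k == i1 then
    F2 * (3^-1 * (F1 * u j1 0%N 0%N - 3 * F2 * u j0 0%N 0%N) - F1_jet u 1 0)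
    - F1 * (3^-1 * (F1 * u j2 0%N 0%N - F2 * u j1 0%N 0%N) - F1_jet u 0 1)
    - 4 / 3 * curl * F1
  else
    F2 * (3^-1 * (F1 * u j2 0%N 0%N - F2 * u j1 0%N 0%N) - F2_jet u 1 0)
    - F1 * (3^-1 * (3 * F1 * u j3 0%N 0%N - F2 * u j2 0%N 0%N) - F2_jet u 0 1)
    - 4 / 3 * curl * F2.

Lemma beta_trace_t h u k :
  (forall m k a b, (a + b <= 2)%N -> lie_jet (h m) u k a b = 0) ->
  (forall m i, h m i 0 0 = (i == m)%:R) ->
  (forall i a b, (a + b <= 1)%N -> lie_coef (h i1) (h i2) i a b = 0) ->
  F2_jet u 0 0 * trace_t h (lie_coef (h i1) (h i2)) i1 k
  - F1_jet u 0 0 * trace_t h (lie_coef (h i1) (h i2)) i2 k = Omega u k.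
Proof.
move=> E h0 star; have EX := E i1; have EY := E i2.
have X1 : h i1 i1 0 0 = 1 by rewrite h0. have X2 : h i1 i2 0 0 = 0 by rewrite h0.
have Y1 : h i2 i1 0 0 = 0 by rewrite h0. have Y2 : h i2 i2 0 0 = 1 by rewrite h0.
have sym := pair_sym X1 X2 Y1 Y2 star.
have [g1 g2 g3 g4] := bracket_g2 EX EY star.
have [L1 L2] := bracket_Liouville EX EY X1 X2 Y1 Y2 star.
have [T11 T12 T22] := bracket_trace EX EY star.
rewrite !(trace_tE h0 sym) //; [|by move=> i; exact: star..].
have := lie_F1 EX; have := lie_F2 EX; have := lie_F1 EY; have := lie_F2 EY.
rewrite X1 X2 Y1 Y2 !sym !mul1r !mul0r !addr0 !add0r => FY2 FY1 FX2 FX1.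
(* The elimination runs backwards: the derivatives of F inside [Omega] are expressed through F and
   the 1-jets of the lifts, and both sides become rational expressions in the same variables. *)
have isolate (a b c d : R) : a + b + c + d = 0 -> a = - (b + c + d).
  by rewrite -!addrA => /eqP; rewrite addr_eq0 => /eqP.
move: FY2 FY1 FX2 FX1 => /isolate FY2 /isolate FY1 /isolate FX2 /isolate FX1.
case: k => -[|[|//]] ltk; rewrite (bool_irrelevance ltk isT) /Omega /=;
  rewrite ?T11 ?T12 ?T22 ?FX1 ?FX2 ?FY1 ?FY2 L1 L2 ?sym; by field.
Qed.

End TraceOfT.

(** * From horizontal subspaces to arrays of coefficients *)

Section HorizontalSubspace.
Variables (R : realType) (theta : Jpi R 3) (H : {vspace jet R 2 4}).
Hypotheses (hor : horizontal theta H) (star : star_condition H).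

Let lift m := Defs.over H (dvec R m).
Let h m := jcoef (lift m).

Lemma over_spec v : Defs.over H v \in H /\ rho 0 (Defs.over H v) = v.
Proof.
case: hor => _ _ _ /(_ v) [xi xiH xiv].
exact: (@xgetPex _ 0 [set xi : jet R 2 4 | xi \in H /\ rho 0 xi = v]
  (ex_intro _ xi (conj xiH xiv))).
Qed.

Lemma over_coord v i : jcoef (Defs.over H v) i 0 0 = jcoef v i 0 0.
Proof. by rewrite -[in RHS](over_spec v).2 jcoef_rho. Qed.

Lemma h_value m i : h m i 0 0 = (i == m)%:R.
Proof. by rewrite /h over_coord jcoef_mkjet. Qed.

Lemma over_linear v : Defs.over H v = \sum_m jcoef v m 0 0 *: lift m.
Proof.
case: (hor) => _ _ inj _; apply: inj.
- exact: (over_spec v).1.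
- by apply: rpred_sum => m _; apply: rpredZ; exact: (over_spec _).1.
apply: jet_eqP => i a b; rewrite leqn0 addn_eq0 => /andP[/eqP-> /eqP->].
have hE m : jcoef (lift m) i 0 0 = (i == m)%:R := h_value m i.
rewrite !jcoef_rho // over_coord sum2E jcoefD !jcoefZ !hE.
by case: i {hE} => -[|[|//]] lti; rewrite (bool_irrelevance lti isT) /=; ring.
Qed.

Lemma h_lie m k a b : (a + b <= 2)%N -> lie_jet (h m) (jcoef theta.2) k a b = 0.
Proof.
by case: hor => _ /(_ _ (over_spec (dvec R m)).1) /Aspace_lie_jet E _ _; exact: E.
Qed.

Lemma h_star i a b : (a + b <= 1)%N -> lie_coef (h i1) (h i2) i a b = 0.
Proof.
move=> ab1; have := star (over_spec (dvec R i1)).1 (over_spec (dvec R i2)).1.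
move=> /(congr1 (fun xi => jcoef xi i a b)).
by rewrite jcoef0 jcoef_rho // jcoef_mkjet // (leq_trans ab1).
Qed.

Lemma t_tensor_trace l k :
  \sum_r comp1 (t_tensor H (dvec R i1) (dvec R i2) (dvec R l) (dvec R r)) r k =
  trace_t h (lie_coef (h i1) (h i2)) l k.
Proof.
set C := lie_coef _ _; apply: eq_bigr => r _; rewrite /comp1 /t_tensor /=.
set w := bracket (rho 3 _) _; set Uw := bracket _ w.
have wE i a b : (a + b <= 2)%N -> jcoef w i a b = lie_coef (h l) C i a b.
  move=> ab2; rewrite jcoef_mkjet //; apply: lie_coef_agree ab2 => {}i {}a {}b ab.
    exact: jcoef_rho.
  exact: jcoef_mkjet.
have UwE i a b : (a + b <= 1)%N -> jcoef Uw i a b = lie_coef (h r) (lie_coef (h l) C) i a b.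
  move=> ab1; rewrite jcoef_mkjet //; apply: lie_coef_agree ab1 => {}i {}a {}b ab.
    exact: jcoef_rho.
  exact: wE.
have k1 : ((k == i1) + (k == i2) <= 1)%N by case: k => -[|[|]].
rewrite jcoefD jcoefN jcoef_rho // over_linear UwE //; congr (_ - _).
rewrite !sum2E jcoefD !jcoefZ !jcoef_rho // !UwE //.
Qed.

(** mu sees only a trace and is linear, so the contraction with beta can be done on the traces
    first. The right side no longer mentions [H], which gives the independence. *)
Lemma omega3E i j k : omega3 (pi_ 2 theta) H (i, j, k) =
  3^-1 * ((i == j)%:R * Omega (jcoef theta.2) k + (i == k)%:R * Omega (jcoef theta.2) j).
Proof.
pose T l m := \sum_r t_slice H (dvec R i1) (dvec R i2) (dvec R l) (r, m, r).
have E m : \sum_l beta (pi_ 2 theta) l * T l m = Omega (jcoef theta.2) m.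
  rewrite -(beta_trace_t m h_lie h_value h_star) sum2E /beta /=.
  rewrite F1_jetE F2_jetE -!t_tensor_trace mulNr.
  by congr (_ * _ - _ * _); apply: eq_bigr => r _; rewrite ffunE.
transitivity (\sum_l beta (pi_ 2 theta) l *
    (3^-1 * ((i == j)%:R * T l k + (i == k)%:R * T l j))).
  by rewrite ffunE; apply: eq_bigr => l _; rewrite ffunE.
rewrite -!E; move: (beta _) T {E} => B T.
by rewrite !sum2E; ring.
Qed.

End HorizontalSubspace.

Theorem theorem6p5 (R : realType) (theta3 : Jpi R 3)
    (theta3_Orb : Orb20 (pi_ 2 theta3)) (H H' : {vspace jet R 2 4})
    (H_horizontal : horizontal theta3 H) (H_star : star_condition H)
    (H'_horizontal : horizontal theta3 H') (H'_star : star_condition H') :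
  omega3 (pi_ 2 theta3) H = omega3 (pi_ 2 theta3) H'.
Proof.
apply/ffunP => -[[i j] k].
exact: etrans (omega3E H_horizontal H_star i j k)
  (esym (omega3E H'_horizontal H'_star i j k)).
Qed.
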